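(* Let $G$ be a finitely generated nilpotent group and $\pi$ a (possibly infinite-dimensional) irreducible complex representation of $G$. Then $\pi$ is monomial if and only if $\pi$ has finite weight.
   Context: Representations are on complex vector spaces without any topological structure, and the group $G$ is considered as an abstract group. A character of a group $H$ is a homomorphism $\chi\colon H\to\mathbb{C}^*$, also regarded as a one-dimensional representation. Finitely induced representation: for a subgroup $H\subset G$ and a representation $\rho$ of $H$ on a vector space $V$, $\operatorname{ind}_H^G(\rho)$ is the space of all functions $f\colon G\to V$ such that $f(hg)=\rho(h)f(g)$ for all $h\in H$, $g\in G$, and such that the support of $f$ is a union of finitely many right cosets $Hg$; $G$ acts by right translations, $(g_0f)(x)=f(xg_0)$. The representation $\pi$ of $G$ is monomial if there are a subgroup $H\subset G$ and a character $\chi$ of $H$ such that $\pi\simeq\operatorname{ind}_H^G(\chi)$. The representation $\pi$ has finite weight if there are a subgroup $H\subset G$ and a character $\chi$ of $H$ such that the vector space $\operatorname{Hom}_H(\chi,\pi|_H)$ is non-zero and finite-dimensional. *)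

(* Defs.v *)
From HB Require Import structures.
From mathcomp Require Import all_boot all_order all_algebra.
From mathcomp Require Import boolp classical_sets functions reals.
From mathcomp Require Import complex.

Set Implicit Arguments.
Unset Strict Implicit.
Unset Printing Implicit Defensive.

Import GRing.Theory.

Local Open Scope classical_set_scope.
Local Open Scope ring_scope.

Section AbstractGroups.
Variable G : groupType.

(* Subgroups are the library's [groupClosed] boolean predicates; by classical
   logic these are all the subgroups of the (possibly infinite) group G. *)
Record subgroup_of (H : groupClosed G) :=
  SubgroupOf { subgroup_val : G; subgroup_valP : subgroup_val \in H }.

HB.instance Definition _ (H : groupClosed G) :=
  [isSub for @subgroup_val H].
HB.instance Definition _ (H : groupClosed G) :=
  [Choice of subgroup_of H by <:].

Lemma groupClosed_closed (H : groupClosed G) : group_closed H.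
Proof.
by split=> [|x y xH yH]; [exact: gpred1 | apply: gpredM => //; exact: gpredVr].
Qed.

HB.instance Definition _ (H : groupClosed G) :=
  SubChoice_isSubGroup.Build G [in H] (subgroup_of H) (groupClosed_closed H).

Definition generated (A : set G) : set G :=
  [set x | forall H : groupClosed G, A `<=` [set` H] -> x \in H].

Definition finitely_generated : Prop :=
  exists s : seq G, generated [set` s] = setT.

Fixpoint lower_central (n : nat) : set G :=
  if n is m.+1 then
    generated [set [~ x, y]%g | x in lower_central m & y in setT]
  else setT.

Definition nilpotent_group : Prop := exists n, lower_central n = [set 1%g].

End AbstractGroups.

Section Representations.
Variable K : fieldType.

(* [Vector.axiom n W] is the type of linear bijections from W onto row vectors
   of length n; W itself carries no finite-dimensional structure. *)
Definition finite_dimensional (W : lmodType K) : Prop :=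
  exists n : nat, inhabited (Vector.axiom n W).

Record representation (G : groupType) (V : lmodType K) := Representation {
  rep_act :> G -> {linear V -> V};
  rep_act1 : forall v, rep_act 1%g v = v;
  rep_actM : forall g h v, rep_act (g * h)%g v = rep_act g (rep_act h v) }.

Definition irreducible (G : groupType) (V : lmodType K)
    (pi : representation G V) : Prop :=
  (exists v : V, v != 0) /\
  forall W : submodClosed V,
    (forall g v, v \in W -> pi g v \in W) ->
    (forall v, v \in W -> v = 0) \/ (forall v, v \in W).

Definition rep_isomorphic (G : groupType) (V W : lmodType K)
    (pi : representation G V) (tau : representation G W) : Prop :=
  exists2 f : {linear V -> W},
    bijective f & forall g v, f (pi g v) = tau g (f v).

Record character (H : groupType) := Character {
  char_fun :> H -> K;
  char_neq0 : forall h, char_fun h != 0;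
  charM : forall h k, char_fun (h * k)%g = char_fun h * char_fun k }.

Section CharRep.
Variables (H : groupType) (chi : character H).

Lemma char1 : chi 1%g = 1.
Proof.
apply: (mulfI (char_neq0 chi 1%g)).
by rewrite -charM mulg1 mulr1.
Qed.

Definition char_act (h : H) (z : K^o) : K^o := chi h *: z.

Lemma char_act_linear h : linear (char_act h).
Proof. by move=> a u v; rewrite /char_act scalerDr !scalerA mulrC. Qed.

HB.instance Definition _ h :=
  GRing.isLinear.Build K K^o K^o *:%R (char_act h) (char_act_linear h).

Lemma char_act1 z : char_act 1%g z = z.
Proof. by rewrite /char_act char1 scale1r. Qed.

Lemma char_actM h k z : char_act (h * k)%g z = char_act h (char_act k z).
Proof. by rewrite /char_act charM scalerA. Qed.

Definition char_rep : representation H K^o :=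
  Representation (rep_act := fun h => char_act h) char_act1 char_actM.

End CharRep.

Section Restriction.
Variables (G : groupType) (V : lmodType K) (pi : representation G V).
Variable H : groupClosed G.

Lemma res_act1 v : pi (val (1%g : subgroup_of H)) v = v.
Proof. exact: rep_act1. Qed.

Lemma res_actM (h k : subgroup_of H) v :
  pi (val (h * k)%g) v = pi (val h) (pi (val k) v).
Proof. exact: rep_actM. Qed.

Definition res_rep : representation (subgroup_of H) V :=
  Representation (rep_act := fun h : subgroup_of H => pi (val h))
    res_act1 res_actM.

End Restriction.

Section Hom.
Variables (H : groupType) (U V : lmodType K).
Variables (sigma : representation H U) (tau : representation H V).

(* The equivariant linear maps, as a submodule of all functions U -> V with
   pointwise operations; [ind_pred] below is likewise a submodule of G -> V. *)
Definition hom_pred : pred (U -> V) := fun f =>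
  `[< linear f /\ forall h u, f (sigma h u) = tau h (f u) >].

Lemma hom_pred_closed : submod_closed hom_pred.
Proof.
split=> [|a f g /asboolP[lf ef] /asboolP[lg eg]]; apply/asboolP.
  split=> [b u v|h u]; first by rewrite /= scaler0 addr0.
  by rewrite /= linear0.
split=> [b u v|h u]; rewrite !fctE; last by rewrite ef eg linearP.
by rewrite lf lg !scalerDr !scalerA addrACA [a * b]mulrC.
Qed.

Record hom_space :=
  HomSpace { hom_val :> U -> V; hom_valP : hom_pred hom_val }.

HB.instance Definition _ := [isSub for hom_val].
HB.instance Definition _ := [Choice of hom_space by <:].
HB.instance Definition _ :=
  GRing.SubChoice_isSubLmodule.Build K (U -> V) hom_pred hom_space
    hom_pred_closed.

End Hom.

Section Induction.
Variables (G : groupType) (H : groupClosed G) (V : lmodType K).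
Variable rho : representation (subgroup_of H) V.

Definition right_coset (g : G) : set G :=
  [set (val h * g)%g | h in [set: subgroup_of H]].

Definition ind_pred : pred (G -> V) := fun f =>
  `[< (forall (h : subgroup_of H) g, f (val h * g)%g = rho h (f g)) /\
      exists s : seq G,
        [set x | f x != 0] = \bigcup_(g in [set` s]) right_coset g >].

(* Covering the support by finitely many cosets suffices: by equivariance the
   support is a union of cosets. *)
Lemma ind_predP (f : G -> V) :
  (forall (h : subgroup_of H) g, f (val h * g)%g = rho h (f g)) ->
  (exists s : seq G, forall x, f x != 0 ->
     exists2 g, g \in s & right_coset g x) ->
  ind_pred f.
Proof.
move=> ef [s sP]; apply/asboolP; split=> //.
exists [seq g <- s | f g != 0]; apply/seteqP; split=> x /=.
  move=> fx; have [g gs [h _ hx]] := sP _ fx.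
  exists g; last by exists h.
  rewrite /= mem_filter gs andbT; apply: contra fx => /eqP fg0.
  by rewrite -hx ef fg0 linear0.
move=> [g /=]; rewrite mem_filter => /andP[fg _] [h _ <-].
apply: contra fg; rewrite ef => /eqP rg0.
by rewrite -[f g](rep_act1 rho) -(mulVg h) rep_actM rg0 linear0.
Qed.

Lemma ind_pred_closed : submod_closed ind_pred.
Proof.
split=> [|a f g /asboolP[ef [s sf]] /asboolP[eg [t tg]]]; apply: ind_predP.
- by move=> h g; rewrite linear0.
- by exists [::] => x; rewrite eqxx.
- by move=> h x; rewrite !fctE ef eg linearP.
exists (s ++ t) => x; rewrite !fctE => fgx.
have [fx|fx] := boolP (f x != 0).
  have: [set x | f x != 0] x by [].
  by rewrite sf => -[k /= ks kx]; exists k; rewrite // mem_cat ks.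
have : [set x | g x != 0] x.
  by move: fgx; rewrite (eqP (negbNE fx)) scaler0 add0r.
by rewrite tg => -[k /= kt kx]; exists k; rewrite // mem_cat kt orbT.
Qed.

Record ind_space :=
  IndSpace { ind_val :> G -> V; ind_valP : ind_pred ind_val }.

HB.instance Definition _ := [isSub for ind_val].
HB.instance Definition _ := [Choice of ind_space by <:].
HB.instance Definition _ :=
  GRing.SubChoice_isSubLmodule.Build K (G -> V) ind_pred ind_space
    ind_pred_closed.

Lemma ind_act_subproof (g0 : G) (f : ind_space) :
  ind_pred (fun x => f (x * g0)%g).
Proof.
case: f => f /= /asboolP[ef [s sf]]; apply: ind_predP => [h g|].
  by rewrite -mulgA ef.
exists [seq (g / g0)%g | g <- s] => x fx.
have : [set x | f x != 0] (x * g0)%g by [].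
rewrite sf => -[g /= gs [h _ hx]].
exists (g / g0)%g; first by apply: map_f.
by exists h => //; rewrite mulgA hx mulgK.
Qed.

Definition ind_act (g0 : G) (f : ind_space) : ind_space :=
  IndSpace (ind_act_subproof g0 f).

Lemma ind_act_linear g0 : linear (ind_act g0).
Proof. by move=> a u v; apply: val_inj; apply/funext => x. Qed.

HB.instance Definition _ g0 :=
  GRing.isLinear.Build K ind_space ind_space *:%R (ind_act g0)
    (ind_act_linear g0).

Lemma ind_act1 f : ind_act 1%g f = f.
Proof. by apply: val_inj; apply/funext => x /=; rewrite mulg1. Qed.

Lemma ind_actM g h f : ind_act (g * h)%g f = ind_act g (ind_act h f).
Proof. by apply: val_inj; apply/funext => x /=; rewrite mulgA. Qed.

Definition ind_rep : representation G ind_space :=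
  Representation (rep_act := fun g => ind_act g) ind_act1 ind_actM.

End Induction.

Definition monomial (G : groupType) (V : lmodType K)
    (pi : representation G V) : Prop :=
  exists (H : groupClosed G) (chi : character (subgroup_of H)),
    rep_isomorphic pi (ind_rep (char_rep chi)).

Definition finite_weight (G : groupType) (V : lmodType K)
    (pi : representation G V) : Prop :=
  exists (H : groupClosed G) (chi : character (subgroup_of H)),
    (exists f : hom_space (char_rep chi) (res_rep pi H), f != 0) /\
    finite_dimensional (hom_space (char_rep chi) (res_rep pi H)).

End Representations.

(* Main.v *)
(* If pi = ind_H^G chi is irreducible, then Hom_H(chi, pi) = End_G(pi) by
   Frobenius reciprocity, and End_G(pi) = C because V has countable dimension
   and C is uncountable and algebraically closed.

   Conversely, enlarge (H, chi): consider subgroups H with a finite-dimensional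
   irreducible H-subspace W of V such that Hom_H(W, V) is finite-dimensional,
   and choose H maximal, which is possible since G is Noetherian. If g
   normalizes H and either a positive power of g lies in H or g W and W are
   isomorphic over H, then <H, g> still has this property, so g lies in H. As G
   is nilpotent, it follows that H contains the roots of its elements, and hence
   that y H has an infinite H-orbit in G / H when y does not normalize H. Along
   the chain of iterated normalizers H < N(H) < N(N(H)) < ... < G, Mackey's
   criterion then shows at each step that the translates of W are in direct sum
   and span an irreducible subspace, so that V = ind_H^G W. Finally W is
   monomial: some a in H is not scalar on W but commutes with H up to scalars,
   W is induced from an eigenspace of a, and one concludes by induction on the
   dimension. *)

From HB Require Import structures.
Require Import Defs.
From mathcomp Require Import all_boot all_order all_algebra.
From mathcomp Require Import boolp classical_sets functions cardinality reals.
From mathcomp Require Import complex ereal topology lebesgue_measure.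

Set Implicit Arguments.
Unset Strict Implicit.
Unset Printing Implicit Defensive.

Import GRing.Theory.

Local Open Scope classical_set_scope.

(** * Subgroups and lower central series *)

(** The pairs (H, W) carry a finite-dimensional W instead of a character because enlarging H
    destroys one-dimensionality: a simple subspace for <H, g> built from translates of a line is in
    general no longer a line. Multiplicity is measured by the sum of all images of W in V, so that
    only subspaces of V and functions on them occur. Mackey's criterion is used only for a subgroup
    normal in the next one, where translates are simple over the same group and can be compared by
    maps; this is why the climb goes through iterated normalizers. Two different reasons exclude
    isomorphic translates: maximality at the first step, infinite orbits of cosets later. The second
    reason needs roots in all of G, whereas maximality yields them only inside the normalizer;
    commutator calculus bridges this gap. The maximal condition on subgroups serves twice: to choose
    H, and to show that an element conjugating H into itself normalizes it. Direct sums are tested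
    on the trivial coset alone, and induced representations appear only at the end, when W has been
    cut down to a line. *)

Section Subgroups.
Local Open Scope group_scope.
Variable G : groupType.
Implicit Types (A B H K L M N : set G) (x y z g h : G).

(** Subgroups are propositional sets, so that families of them and iterated normalizers are formed
    freely; [subgroup_groupClosed] and [groupClosed_subgroup] pass to and from the predicates of the
    statement. *)
Definition subgroup H :=
  [/\ H 1, forall x y, H x -> H y -> H (x * y) & forall x, H x -> H x^-1].

Section ToGroupClosed.
Variables (H : set G) (sH : subgroup H).

Definition subgroup_pred : {pred G} := fun x => `[< H x >].

Lemma subgroup_predV : {in subgroup_pred, forall x, x^-1 \in subgroup_pred}.
Proof. by case: sH => _ _ HV x /asboolP Hx; apply/asboolP/HV. Qed.

Lemma subgroup_pred1 : 1 \in subgroup_pred.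
Proof. by case: sH => H1 _ _; apply/asboolP. Qed.

Lemma subgroup_predM :
  {in subgroup_pred &, forall x y, x * y \in subgroup_pred}.
Proof.
by case: sH => _ HM _ x y /asboolP Hx /asboolP Hy; apply/asboolP/HM.
Qed.

Lemma subgroup_groupClosed : exists C :
  groupClosed G, forall x, (x \in C) <-> H x.
Proof.
pose C := HB.pack_for (groupClosed G) subgroup_pred
  (isInvClosed.Build G subgroup_pred subgroup_predV)
  (isMul1Closed.Build G subgroup_pred subgroup_pred1)
  (isMulClosed.Build G subgroup_pred subgroup_predM).
by exists C => x; split=> [/asboolP|Hx] //; apply/asboolP.
Qed.

End ToGroupClosed.

Lemma groupClosed_subgroup (C : groupClosed G) : subgroup [set` C].
Proof. by split=> [|x y|x] /=; [exact: gpred1|exact: gpredM|exact: gpredVr].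
Qed.

Lemma subgroupM H x y : subgroup H -> H x -> H y -> H (x * y).
Proof. by case=> _ HM _; exact: HM. Qed.

Lemma subgroupV H x : subgroup H -> H x -> H x^-1.
Proof. by case=> _ _; exact. Qed.

Lemma subgroupVr H x : subgroup H -> H x^-1 -> H x.
Proof. by move=> sH /(subgroupV sH); rewrite invgK. Qed.

Lemma subgroupX H x n : subgroup H -> H x -> H (x ^+ n).
Proof.
move=> sH Hx; elim: n => [|n IH]; first by case: sH.
by rewrite expgS; apply: subgroupM.
Qed.

Lemma subgroupMl H x y : subgroup H -> H x -> H (x * y) <-> H y.
Proof.
move=> sH Hx; split=> [Hxy|]; last exact: subgroupM.
by rewrite -(mulKg x y); apply: subgroupM => //; apply: subgroupV.
Qed.

Lemma subgroupMr H x y : subgroup H -> H y -> H (x * y) <-> H x.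
Proof.
move=> sH Hy; split=> [Hxy|Hx]; last exact: subgroupM.
by rewrite -(mulgK y x); apply: subgroupM => //; apply: subgroupV.
Qed.

Lemma subgroupJ H x y : subgroup H -> H x -> H y -> H (x ^ y).
Proof.
by move=> sH Hx Hy; apply: subgroupM; [|exact: subgroupV|exact: subgroupM].
Qed.

Lemma subgroupT : subgroup [set: G]. Proof. by []. Qed.

Lemma generated_min A H : subgroup H -> A `<=` H -> generated A `<=` H.
Proof.
move=> sH AH x gx; have [C CP] := subgroup_groupClosed sH.
by apply/CP; apply: gx => y /AH /CP.
Qed.

Lemma sub_generated A : A `<=` generated A.
Proof. by move=> x Ax H; apply. Qed.

Lemma generated_subgroup A : subgroup (generated A).
Proof.
split=> [H _|x y gx gy H AH|x gx H AH]; first exact: gpred1.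
  by apply: gpredM; [exact: gx|exact: gy].
by apply: gpredVr; exact: gx.
Qed.

Lemma generated_mono A B : A `<=` B -> generated A `<=` generated B.
Proof.
move=> AB; apply: generated_min; first exact: generated_subgroup.
by move=> x /AB; apply: sub_generated.
Qed.

Lemma commMg x y z : [~ x * y, z] = [~ x, z] ^ y * [~ y, z].
Proof. by rewrite /commg /conjg !invgM !mulgA !mulgK. Qed.

Lemma commgM x y z : [~ x, y * z] = [~ x, z] * [~ x, y] ^ z.
Proof. by rewrite /commg /conjg !invgM -!mulgA mulVKg mulVKg. Qed.

Lemma mulg_comm x y : x * [~ x, y] = x ^ y.
Proof. by rewrite /commg mulVKg. Qed.

Lemma commVg x y : [~ x^-1, y] = ([~ x, y] ^ x^-1)^-1.
Proof. by apply/esym/mulg1_eq; rewrite -commMg mulgV comm1g. Qed.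

Lemma commgV x y : [~ x, y^-1] = ([~ x, y] ^ y^-1)^-1.
Proof. by apply/eqP; rewrite -mulg_eq1 -commgM mulgV commg1. Qed.

(** The series is relative to [L], because the isolator argument runs it inside [<K, g>] and not
    only inside [G]. *)
Fixpoint lcs L n : set G :=
  if n is m.+1 then generated [set [~ x, y] | x in lcs L m & y in L] else L.

Lemma lower_central_lcs n : lower_central n = lcs [set: G] n.
Proof. by elim: n => //= n ->. Qed.

Lemma lcs_subgroup L n : subgroup L -> subgroup (lcs L n).
Proof. by case: n => //= n _; apply: generated_subgroup. Qed.

Lemma lcs_comm L n x y : lcs L n x -> L y -> lcs L n.+1 [~ x, y].
Proof. by move=> nx Ly; apply: sub_generated; exists x => //; exists y. Qed.

Lemma lcs_min L n H : subgroup H ->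
  (forall x y, lcs L n x -> L y -> H [~ x, y]) -> lcs L n.+1 `<=` H.
Proof.
by move=> sH HP; apply: generated_min => // _ [x nx [y Ly <-]]; apply: HP.
Qed.

Lemma lcs_desc L n : subgroup L -> lcs L n.+1 `<=` lcs L n.
Proof.
move=> sL; elim: n => [|n IH].
  apply: lcs_min => // x y /= Lx Ly.
  by apply: subgroupM => //; [apply: subgroupV|apply: subgroupJ].
apply: lcs_min => [|x y nx Ly]; first exact: lcs_subgroup.
by apply: lcs_comm => //; apply: IH.
Qed.

Lemma lcs_sub L n : subgroup L -> lcs L n `<=` L.
Proof.
by move=> sL; elim: n => //= n IH x /(lcs_desc sL) /IH.
Qed.

Lemma lcs_mono L M n : L `<=` M -> lcs L n `<=` lcs M n.
Proof.
move=> LM; elim: n => //= n IH; apply: generated_mono => _ [x nx [y Ly <-]].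
by exists x; [apply: IH|exists y => //; apply: LM].
Qed.

(** Since [x ^ y = x * [~ x, y]], any subgroup between two consecutive terms of the series is closed
    under conjugation by [L]. *)
Lemma lcs_absorb L n H x y : subgroup L -> subgroup H -> lcs L n.+1 `<=` H ->
  H `<=` lcs L n -> H x -> L y -> H (x ^ y).
Proof.
move=> sL sH nH Hn Hx Ly; rewrite -mulg_comm; apply: subgroupM => //.
by apply: nH; apply: lcs_comm => //; apply: Hn.
Qed.

Lemma lcsJ L n x y : subgroup L -> lcs L n x -> L y -> lcs L n (x ^ y).
Proof.
move=> sL; apply: (@lcs_absorb _ n) => //; first exact: lcs_subgroup.
exact: lcs_desc.
Qed.

(* Commutators with a fixed element are multiplicative modulo the next term,
   so [~ x, y] stays in H when x ranges over a subgroup. *)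
Lemma lcs_comml L n H S y : subgroup L -> subgroup H -> lcs L n.+2 `<=` H ->
  H `<=` lcs L n.+1 -> L y -> S `<=` lcs L n -> (forall x, S x -> H [~ x, y]) ->
  forall x, generated S x -> H [~ x, y].
Proof.
move=> sL sH nH Hn Ly Sn SH x Sx.
have sn := lcs_subgroup n sL.
suff: generated S `<=` [set x | lcs L n x /\ H [~ x, y]] by move/(_ _ Sx) => [].
apply: generated_min => [|z Sz]; last by split; [apply: Sn|apply: SH].
have absorb u v : H u -> lcs L n v -> H (u ^ v).
  by move=> Hu /(lcs_sub sL); apply: (@lcs_absorb L n.+1).
split=> [|u v [nu Hu] [nv Hv]|u [nu Hu]] /=.
- by rewrite comm1g; case: sn; case: sH.
- split; first exact: subgroupM.
  by rewrite commMg; apply: subgroupM => //; apply: absorb.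
have nV := subgroupV sn nu; split=> //.
by rewrite commVg; apply: subgroupV => //; apply: absorb.
Qed.

Lemma lcs_commr L n H S x : subgroup L -> subgroup H -> lcs L n.+2 `<=` H ->
  H `<=` lcs L n.+1 -> S `<=` L -> (forall y, S y -> H [~ x, y]) ->
  forall y, generated S y -> H [~ x, y].
Proof.
move=> sL sH nH Hn SL SH y Sy.
suff: generated S `<=` [set y | L y /\ H [~ x, y]] by move/(_ _ Sy) => [].
apply: generated_min => [|z Sz]; last by split; [apply: SL|apply: SH].
have absorb u v : H u -> L v -> H (u ^ v) by apply: (@lcs_absorb L n.+1).
split=> [|u v [nu Hu] [nv Hv]|u [nu Hu]] /=.
- by rewrite commg1; case: sL; case: sH.
- split; first exact: subgroupM.
  by rewrite commgM; apply: subgroupM => //; apply: absorb.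
have nV := subgroupV sL nu; split=> //.
by rewrite commgV; apply: subgroupV => //; apply: absorb.
Qed.

End Subgroups.

(** * Maximal condition *)

Section MaximalCondition.
Local Open Scope group_scope.
Variable G : groupType.
Implicit Types (A B H K L M N : set G) (F : set (set G)) (x y z g h : G).

(* Relative to A, so that the condition can be propagated up a series of
   subgroups with cyclic quotients. *)
Definition max_on A := forall F, (forall H, F H -> subgroup H) ->
  (exists H, F H) ->
  exists2 H, F H & forall H', F H' -> H `<=` H' -> H' `&` A `<=` H.

Lemma mulgACJ x y z t : x * y * (z * t) = x * z ^ y^-1 * (y * t).
Proof. by rewrite conjgE invgK !mulgA mulgVK. Qed.

Lemma generated_cyclic A a b : subgroup A ->
  (forall x, A x -> A (x ^ a) /\ A (x ^ a^-1)) ->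
  generated (A `|` [set a]) b ->
  exists n, exists2 x, A x & b = x * a ^+ n \/ b^-1 = x * a ^+ n.
Proof.
move=> sA Aa gb.
have AX n x : A x -> A (x ^ (a ^+ n)) /\ A (x ^ (a ^- n)).
  move=> Ax; elim: n => [|n [IH1 IH2]]; first by rewrite invg1 conjg1.
  rewrite {1}expgSr expgS invgM !conjgM.
  by split; [case: (Aa _ IH1)|case: (Aa _ IH2)].
(* Integer powers of [a] are written as quotients of natural ones; the larger exponent decides at
   the end between [b] and [b^-1]. *)
pose c n m := a ^+ n / a ^+ m.
have AV n m x : A x -> A (x ^ c n m).
  by move=> Ax; rewrite conjgM; apply: (AX _ _ _).2; apply: (AX _ _ _).1.
have cV n m : (c n m)^-1 = c m n by rewrite invgM invgK.
have cM n m n' m' : c n m * c n' m' = c (n + n')%N (m + m')%N.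
  rewrite /c (addnC m) !expgnDr invgM !mulgA; congr (_ * _).
  rewrite -!mulgA; congr (_ * _).
  by apply/commute_sym/commuteV/commuteX2.
have: exists n m, exists2 x, A x & b = x * c n m.
  suff: generated (A `|` [set a]) `<=`
      [set b | exists n m, exists2 x, A x & b = x * c n m] by apply.
  apply: generated_min => [|x [Ax|->]]; last 2 first.
  - by exists 0%N, 0%N; exists x => //; rewrite /c mulgV mulg1.
  - by exists 1%N, 0%N; exists 1; [case: sA|rewrite /c divg1 mul1g].
  split=> [|_ _ [n [m [x Ax ->]]] [n' [m' [x' Ax' ->]]]|_ [n [m [x Ax ->]]]].
  - by exists 0%N, 0%N; exists 1; [case: sA|rewrite /c mulgV mulg1].
  - exists (n + n')%N, (m + m')%N; exists (x * x' ^ c m n).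
      by apply: subgroupM => //; apply: AV.
    by rewrite mulgACJ cM cV.
  exists m, n; exists (x^-1 ^ c n m); first by apply: AV; apply: subgroupV.
  by rewrite invgM [LHS]conjgCV invgK cV.
case=> n [m [x Ax ->]]; have [le_mn|/ltnW le_nm] := leqP m n.
  by exists (n - m)%N; exists x => //; left; rewrite expgnFr.
exists (m - n)%N; exists (x^-1 ^ c n m); first by apply: AV; apply: subgroupV.
by right; rewrite invgM [LHS]conjgCV invgK cV /c expgnFr.
Qed.

Lemma max_on_sub A B : A `<=` B -> max_on B -> max_on A.
Proof.
move=> AB mB F sF F0; have [H FH HP] := mB F sF F0.
by exists H => // H' FH' HH' x [H'x /AB Bx]; apply: (HP H').
Qed.

(** The argument of Hilbert's basis theorem. Once [H0] has maximal trace on [A], one minimizes the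
    positive exponent with which some member of [F] above [H0] meets a coset [A * a ^+ d]. The
    minimum also binds all larger members, so Euclidean division of exponents brings any element of
    [H'] down to the trace on [A]. *)
Lemma max_on_cyclic A a : subgroup A ->
  (forall x, A x -> A (x ^ a) /\ A (x ^ a^-1)) ->
  max_on A -> max_on (generated (A `|` [set a])).
Proof.
move=> sA Aa mA F sF F0; have [H0 FH0 H0P] := mA F sF F0.
pose P d := `[< exists2 H, F H /\ H0 `<=` H & exists2 x, A x & H (x * a ^+
  d.+1) >].
suff [H [FH HH0] HP] : exists2 H, F H /\ H0 `<=` H & forall H', F H' -> H `<=`
  H' -> forall n x, A x -> H' (x * a ^+ n) -> H (x * a ^+ n).
  exists H => // H' FH' HH' b [H'b gb].
  have [n [x Ax [bE|bE]]] := generated_cyclic sA Aa gb.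
    by rewrite bE; apply: (HP H') => //; rewrite -bE.
  by apply: subgroupVr; [exact: sF|rewrite bE; apply: (HP H') => //;
    rewrite -bE;
    apply: subgroupV => //; apply: sF].
have [[d Pd]|nP] := pselect (exists d, P d); last first.
  exists H0; first by split.
  move=> H' FH' HH' [|n] x Ax H'x; last first.
    by exfalso; apply: nP; exists n; apply/asboolP; exists H' => //; exists x.
  by move: H'x; rewrite mulg1 => H'x; apply: (H0P H').
have [d' /asboolP[H [FH HH0] [y Ay Hy]] dmin] := ex_minnP (ex_intro _ d Pd).
exists H => // H' FH' HH' n; elim/ltn_ind: n => n IH x Ax H'x.
have [le_dn|lt_nd] := ltnP d' n; last first.
  case: n lt_nd H'x IH => [_|n lt_nd H'x _].
    by rewrite mulg1 => H'x _; apply: (HH0); apply: (H0P H') => //;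
      exact: subset_trans HH'.
  suff /dmin : P n by rewrite leqNgt lt_nd.
  by apply/asboolP; exists H'; [split=> //; apply: subset_trans HH'|exists x].
have sH := sF _ FH; have sH' := sF _ FH'.
have AX m z : A z -> A (z ^ (a ^- m)).
  move=> Az; elim: m => [|m IHm]; first by rewrite invg1 conjg1.
  by rewrite expgS invgM conjgM; case: (Aa _ IHm).
have E : x * a ^+ n / (y * a ^+ d'.+1) = x * y^-1 ^ (a ^- (n - d'.+1)) * a ^+
  (n - d'.+1).
  by rewrite conjgE invgK !mulgA mulgVK expgnFr // invgM !mulgA.
rewrite -(mulgVK (y * a ^+ d'.+1) (x * a ^+ n)) E.
apply: subgroupM => //; apply: IH.
- by rewrite ltn_subrL /= (leq_trans _ le_dn).
- by apply: subgroupM => //; apply: AX; apply: subgroupV.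
by rewrite -E; apply: subgroupM => //; apply: subgroupV => //; apply: HH'.
Qed.

(** Every intermediate subgroup lies between two consecutive terms, so adjoining the generators one
    by one gives cyclic extensions. *)
Lemma max_on_generated_seq L n (s : seq G) A : subgroup L -> subgroup A ->
  lcs L n.+1 `<=` A -> A `<=` lcs L n -> [set` s] `<=` lcs L n ->
  max_on A -> max_on (generated (A `|` [set` s])).
Proof.
move=> sL; elim: s A => [|a s IH] A sA nA An sn mA.
  apply: max_on_sub mA; apply: generated_min => // x [//|];
    by rewrite /= in_nil.
have an : lcs L n a by apply: sn; rewrite /= inE eqxx.
have mAa : max_on (generated (A `|` [set a])).
  have La := lcs_sub sL an.
  apply: max_on_cyclic => // x Ax; split;
    apply: (lcs_absorb sL sA nA An Ax) => //.
  exact: subgroupV.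
have {}IH := IH (generated (A `|` [set a])).
apply: max_on_sub (IH _ _ _ _ mAa).
- apply: generated_min; first exact: generated_subgroup.
  move=> x [Ax|]; first by apply: sub_generated; left; apply: sub_generated;
    left.
  rewrite /= inE => /predU1P[->|xs]; apply: sub_generated; last by right.
  by left; apply: sub_generated; right.
- exact: generated_subgroup.
- by move=> x nx; apply: sub_generated; left; apply: nA.
- by apply: generated_min; [exact: lcs_subgroup|move=> x [/An//|->]].
- by move=> x xs; apply: sn; rewrite /= inE (xs : x \in s) orbT.
Qed.

(** Modulo the term after next the commutator is multiplicative in each entry, so commutators of
    generators suffice. *)
Lemma lcs_fg n : finitely_generated G -> exists2 s : seq G,
  [set` s] `<=` lcs [set: G] n & lcs [set: G] n `<=` generated (lcs [set: G]
    n.+1 `|` [set` s]).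
Proof.
move=> [t tG]; elim: n => [|n [s sn ns]].
  exists t => // x _; apply: (@generated_mono _ [set` t]); first by move=> y;
    right.
  by rewrite tG.
exists [seq [~ x, y] | x <- s, y <- t] => [_ /= /allpairsP[[x y] [xs yt ->]]|].
  by apply: lcs_comm => //; apply: sn.
set s' := [seq _ | _ <- _, _ <- _]; set H := generated _.
have sH : subgroup H by exact: generated_subgroup.
have nH : lcs [set: G] n.+2 `<=` H by move=> x nx; apply: sub_generated; left.
have Hn : H `<=` lcs [set: G] n.+1.
  apply: generated_min => [|z [/(lcs_desc (@subgroupT G)) //|]];
    first exact: lcs_subgroup.
  by move=> /= /allpairsP[[x y] [xs yt ->]]; apply: lcs_comm => //; apply: sn.
have sT := @subgroupT G.
apply: lcs_min => // x y nx _.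
have : generated [set` t] y by rewrite tG.
apply: (lcs_commr sT sH nH Hn _ _) => // {}y yt.
apply: (lcs_comml sT sH nH Hn _ _ _ (ns _ nx)) => // z [nz|zs].
- exact: lcs_desc.
- exact: sn.
- by apply: nH; apply: lcs_comm.
by apply: sub_generated; right; apply/allpairsP; exists (z, y).
Qed.

(** The condition is trivial on the last term of the lower central series and is carried up to [G],
    each term being generated over the next one by a finite set. *)
Lemma maximal_condition F : finitely_generated G -> nilpotent_group G ->
  (forall H, F H -> subgroup H) -> (exists H, F H) ->
  exists2 H, F H & forall H', F H' -> H `<=` H' -> H' = H.
Proof.
move=> fgG [c]; rewrite lower_central_lcs => c1 sF F0.
suff mG : max_on [set: G].
  have [H FH HP] := mG F sF F0; exists H => // H' FH' HH'.
  by apply/seteqP; split=> // x H'x; apply: (HP H').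
have sT := @subgroupT G.
have m1 : max_on (lcs [set: G] c).
  move=> F' sF' [H FH]; exists H => // H' _ _ x []; rewrite c1 => _ ->.
  by case: (sF' _ FH).
have {c1 m1 F sF F0} : forall i, max_on (lcs [set: G] (c - i)).
  elim=> [|i IH]; first by rewrite subn0.
  rewrite subnS; case: (c - i)%N IH => //= n mn.
  have [s sn ns] := lcs_fg n fgG.
  apply: max_on_sub ns _; apply: (@max_on_generated_seq [set: G] n) => //.
  - exact: (@lcs_subgroup _ _ n.+1).
  - exact: lcs_desc.
by move/(_ c); rewrite subnn.
Qed.

End MaximalCondition.

(** * Normalizers and isolated subgroups *)

Section Isolators.
Local Open Scope group_scope.
Variable G : groupType.
Implicit Types (A B H K L M N : set G) (x y z g h : G).

(** An equivalence, since in an infinite group an element may conjugate [H] into a proper subgroup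
    of itself. *)
Definition normalizer H : set G := [set g | forall h, H (h ^ g) <-> H h].

Lemma normalizer_subgroup H : subgroup (normalizer H).
Proof.
split=> [h|x y xN yN h|x xN h]; first by rewrite conjg1.
  by rewrite conjgM yN xN.
by rewrite -[h in X in _ <-> X](conjgKV x) xN.
Qed.

Lemma sub_normalizer H : subgroup H -> H `<=` normalizer H.
Proof.
move=> sH g Hg h; split=> [|Hh]; last exact: subgroupJ.
by move=> /subgroupJ => /(_ g^-1 sH (subgroupV sH Hg)); rewrite conjgK.
Qed.

Lemma lcs_normalizer L n H x : subgroup L -> subgroup H -> H `<=` L ->
  lcs L n.+1 `<=` H -> lcs L n x -> normalizer H x.
Proof.
move=> sL sH HL nH nx h.
have JH z k : lcs L n z -> H k -> H (k ^ z).
  move=> nz Hk; rewrite -mulg_comm; apply: subgroupM => //; rewrite -invgR.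
  by apply: subgroupV => //; apply: nH; apply: lcs_comm => //; apply: HL.
split=> [Hhx|]; last exact: JH.
by rewrite -(conjgK x h); apply: JH => //; apply: subgroupV => //;
  apply: lcs_subgroup.
Qed.

Fixpoint iter_normalizer H n : set G :=
  if n is m.+1 then normalizer (iter_normalizer H m) else H.

Lemma iter_normalizer_subgroup H n : subgroup H ->
  subgroup (iter_normalizer H n).
Proof. by case: n => //= n _; apply: normalizer_subgroup. Qed.

(** By [lcs_normalizer], each normalizer absorbs one more term of the lower central series, counted
    from its trivial end. *)
Lemma iter_normalizer_full H : nilpotent_group G -> subgroup H ->
  exists n, iter_normalizer H n = setT.
Proof.
move=> [c]; rewrite lower_central_lcs => c1 sH; exists c.
suff: forall i, lcs [set: G] (c - i) `<=` iter_normalizer H i.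
  by move/(_ c); rewrite subnn => cT; apply/seteqP; split=> // x _; apply: cT.
elim=> [|i IH]; first by rewrite subn0 c1 => _ ->; case: sH.
have sNi := iter_normalizer_subgroup i sH.
rewrite subnS; case: (c - i)%N IH => [|n] IH x nx.
  by apply: sub_normalizer => //; apply: IH.
exact: (lcs_normalizer (@subgroupT G) sNi _ IH nx).
Qed.

Section CentralModulo.
Variables (L A : set G) (n : nat).
Hypotheses (sL : subgroup L) (sA : subgroup A).
Hypotheses (nA : lcs L n.+1 `<=` A) (An : A `<=` lcs L n).

(** Congruence modulo [A], in place of the quotient of [L] by [A]; the image of [lcs L n] is central
    there ([eqA_conj]). *)
Let eqA x y := A (x^-1 * y).

Let eqAJ x y : L y -> A x -> A (x ^ y).
Proof. by move=> Ly Ax; apply: (lcs_absorb sL sA nA). Qed.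

Let eqA_refl x : eqA x x.
Proof. by rewrite /eqA mulVg; case: sA. Qed.

Let eqA_trans x y z : eqA x y -> eqA y z -> eqA x z.
Proof. by move=> xy /(subgroupM sA xy); rewrite -mulgA mulVKg. Qed.

Let eqA_mul x x' y y' : L y -> eqA x x' -> eqA y y' -> eqA (x * y) (x' * y').
Proof.
move=> Ly xx' yy'; rewrite /eqA.
suff -> : (x * y)^-1 * (x' * y') = (x^-1 * x') ^ y * (y^-1 * y').
  by apply: subgroupM => //; apply: eqAJ.
by rewrite conjgE invgM -!mulgA mulVKg.
Qed.

Let eqA_pow x y k : L x -> eqA x y -> eqA (x ^+ k) (y ^+ k).
Proof.
move=> Lx xy; elim: k => [|k IH]; first exact: eqA_refl.
by rewrite !expgS; apply: eqA_mul => //; apply: subgroupX.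
Qed.

Let eqA_in x y : A x -> eqA x y -> A y.
Proof. by move=> Ax /(subgroupM sA Ax); rewrite mulVKg. Qed.

Let eqA_conj x y : lcs L n x -> L y -> eqA x (x ^ y).
Proof. by move=> nx Ly; apply: nA; apply: lcs_comm. Qed.

Let eqA_sym x y : eqA x y -> eqA y x.
Proof. by move/(subgroupV sA); rewrite invgM invgK. Qed.

(** Both elements are central modulo [A], so the power map is multiplicative on them. *)
Lemma pow_mul_mod x y k : lcs L n x -> lcs L n y ->
  A (x ^+ k) -> A (y ^+ k) -> A ((x * y) ^+ k).
Proof.
move=> nx ny Axk Ayk; apply: (@eqA_in (x ^+ k * y ^+ k));
  first exact: subgroupM.
have Lx := lcs_sub sL nx; have Ly := lcs_sub sL ny.
elim: k {Axk Ayk} => [|k IH]; first by rewrite mulg1; apply: eqA_refl.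
have [Lxk Lyk] : L (x ^+ k) /\ L (y ^+ k) by split; apply: subgroupX.
apply: (@eqA_trans _ (x * y * (x ^+ k * y ^+ k))); last first.
  by rewrite !expgS; apply: eqA_mul => //; apply: subgroupM.
have -> : x * y * (x ^+ k * y ^+ k) = x * x ^+ k * (y ^ (x ^+ k) * y ^+ k).
  by rewrite conjgE -!mulgA mulVKg.
rewrite !expgS; apply: eqA_mul => //; first exact: subgroupM.
by apply: eqA_mul => //; apply: eqA_conj.
Qed.

(** Commutators of [lcs L p] with [L] fall in [lcs L n], central modulo [A]; they are therefore
    multiplicative in each entry. *)
Let commXg_mod x y k p : n = p.+1 -> lcs L p x -> L y ->
  eqA ([~ x, y] ^+ k) [~ x ^+ k, y].
Proof.
move=> np nx Ly; have Lx := lcs_sub sL nx; have := lcs_comm nx Ly;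
  rewrite -np => nxy.
have Lxy := lcs_sub sL nxy.
elim: k => [|k IH]; first by rewrite comm1g; apply: eqA_refl.
rewrite !expgS commMg; apply: eqA_mul => //; first exact: subgroupX.
by apply: eqA_conj => //; apply: subgroupX.
Qed.

Let commgX_mod x y k p : n = p.+1 -> lcs L p x -> L y ->
  eqA ([~ x, y] ^+ k) [~ x, y ^+ k].
Proof.
move=> np nx Ly; have Lx := lcs_sub sL nx; have := lcs_comm nx Ly;
  rewrite -np => nxy.
have Lxy := lcs_sub sL nxy.
elim: k => [|k IH]; first by rewrite commg1; apply: eqA_refl.
rewrite [y ^+ _]expgSr commgM expgS; apply: eqA_mul => //;
  first exact: subgroupX.
apply: eqA_trans IH _; apply: eqA_conj => //; rewrite np; apply: lcs_comm => //.
exact: subgroupX.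
Qed.

Lemma pow_commXg_mod x y k j p : n = p.+1 -> lcs L p x -> L y ->
  A ([~ x ^+ k, y] ^+ j) -> A ([~ x, y] ^+ (k * j)).
Proof.
move=> np nx Ly; have Lx := lcs_sub sL nx.
have Lxy : L [~ x, y] by apply: (lcs_sub sL (lcs_comm nx Ly)).
have Lxky : L [~ x ^+ k, y].
  by apply: (lcs_sub sL (@lcs_comm _ _ 0 _ _ _ Ly)); apply: subgroupX.
rewrite expgnA => /eqA_in; apply; apply: eqA_pow => //.
exact: eqA_sym (commXg_mod k np nx Ly).
Qed.

Lemma pow_commgX_mod x y k p : n = p.+1 -> lcs L p x -> L y ->
  A [~ x, y ^+ k] -> A ([~ x, y] ^+ k).
Proof.
move=> np nx Ly /eqA_in; apply; exact: eqA_sym (commgX_mod k np nx Ly).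
Qed.

(** Modulo [A], sending [x] to [[~ x, y] ^+ k] is a homomorphism on [lcs L p], so generators
    suffice. *)
Lemma commMl_pow_mod S y k p : n = p.+1 -> L y -> S `<=` lcs L p ->
  (forall x, S x -> A ([~ x, y] ^+ k)) ->
  forall x, generated S x -> A ([~ x, y] ^+ k).
Proof.
move=> np Ly Sn SA x Sx; have sn := lcs_subgroup p sL.
suff: generated S `<=` [set x | lcs L p x /\ A ([~ x, y] ^+ k)].
  by move/(_ _ Sx) => [].
apply: generated_min => [|z Sz]; last by split; [apply: Sn|apply: SA].
split=> [|u v [nu Au] [nv Av]|u [nu Au]] /=.
- by rewrite comm1g expg1n; case: sn; case: sA.
- split; first exact: subgroupM.
  have Lv := lcs_sub sL nv.
  rewrite commMg; apply: pow_mul_mod => //; try by rewrite np; apply: lcs_comm.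
    by rewrite np; apply: lcsJ => //; apply: lcs_comm.
  by rewrite -conjXg; apply: eqAJ.
have nV := subgroupV sn nu; split=> //.
rewrite commVg expVgn; apply: subgroupV => //; rewrite -conjXg;
  apply: eqAJ => //.
exact: lcs_sub nV.
Qed.

Lemma commMr_pow_mod S x k p : n = p.+1 -> lcs L p x -> S `<=` L ->
  (forall y, S y -> A ([~ x, y] ^+ k)) ->
  forall y, generated S y -> A ([~ x, y] ^+ k).
Proof.
move=> np nx SL SA y Sy.
suff: generated S `<=` [set y | L y /\ A ([~ x, y] ^+ k)].
  by move/(_ _ Sy) => [].
apply: generated_min => [|z Sz]; last by split; [apply: SL|apply: SA].
split=> [|u v [Lu Au] [Lv Av]|u [Lu Au]] /=.
- by rewrite commg1 expg1n; case: sL; case: sA.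
- split; first exact: subgroupM.
  rewrite commgM; apply: pow_mul_mod => //; try by rewrite np; apply: lcs_comm.
    by rewrite np; apply: lcsJ => //; apply: lcs_comm.
  by rewrite -conjXg; apply: eqAJ.
have LV := subgroupV sL Lu; split=> //.
by rewrite commgV expVgn; apply: subgroupV => //; rewrite -conjXg; apply: eqAJ.
Qed.

End CentralModulo.

Section Roots.
Variables (K : set G) (g : G) (m : nat).
Hypotheses (sK : subgroup K) (Kgm : K (g ^+ m)).

Let L := generated (K `|` [set g]).
Let sL : subgroup L. Proof. exact: generated_subgroup. Qed.
Let KL : K `<=` L. Proof. by move=> x Kx; apply: sub_generated; left. Qed.

(* In the quotient by the next term, iterated commutators are multilinear:
   each entry g can be replaced by g ^+ m at the cost of one power m. *)
Lemma lcs_root n x : lcs L n x ->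
  generated ((K `&` lcs L n) `|` lcs L n.+1) (x ^+ (m ^ n.+1)).
Proof.
pose A i := generated ((K `&` lcs L i) `|` lcs L i.+1).
have sA i : subgroup (A i) by exact: generated_subgroup.
have nA i : lcs L i.+1 `<=` A i by move=> z nz; apply: sub_generated; right.
have KA i z : K z -> lcs L i z -> A i z.
  by move=> Kz nz; apply: sub_generated; left.
have An i : A i `<=` lcs L i.
  apply: generated_min => [|z [[]|] //]; first exact: lcs_subgroup.
  exact: lcs_desc.
elim: n x => [|n IH] x.
  have subQ : subgroup [set x | L x /\ A 0 (x ^+ m)].
    split=> [|u v [Lu Au] [Lv Av]|u [Lu Au]] /=.
    - by rewrite expg1n; case: (sA 0); case: sL.
    - split; first exact: (subgroupM sL).
      exact: (pow_mul_mod sL (sA 0%N) (nA _) (An _)).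
    - by split; [apply: (subgroupV sL)|rewrite expVgn;
      apply: (subgroupV (sA 0%N))].
  suff: L `<=` [set x | L x /\ A 0 (x ^+ m)] by move=> QP /QP [].
  apply: generated_min => // z [Kz|->]; split.
  - exact: KL.
  - by apply: KA; [apply: subgroupX|apply: (subgroupX m sL); apply: KL].
  - by apply: sub_generated; right.
  - by apply: KA => //; apply: KL.
set M := (m ^ n.+1)%N in IH *.
have subQ : subgroup [set z | lcs L n.+1 z /\ A n.+1 (z ^+ (m * M))].
  have sn := lcs_subgroup n.+1 sL.
  split=> [|u v [Lu Au] [Lv Av]|u [Lu Au]] /=.
  - by rewrite expg1n; case: sn; case: (sA n.+1).
  - split; first exact: (subgroupM sn).
    exact: (pow_mul_mod sL (sA n.+1) (nA _) (An _)).
  - by split; [apply: (subgroupV sn)|rewrite expVgn;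
    apply: (subgroupV (sA n.+1))].
rewrite expnS -/M => nx; suff: lcs L n.+1 `<=` [set z | lcs L n.+1 z /\ A n.+1
  (z ^+ (m * M))].
  by move/(_ _ nx) => [].
have nA1 := nA n.+1; have An1 := An n.+1; have sA1 := sA n.+1.
have Lg : L g by apply: sub_generated; right.
apply: lcs_min => // {nx}x y nx Ly; split; first exact: lcs_comm.
have AxM : A n (x ^+ M) by apply: IH.
have Sn : (K `&` lcs L n) `|` lcs L n.+1 `<=` lcs L n.
  by move=> z [[]|/(lcs_desc sL)].
apply: (commMr_pow_mod sL sA1 nA1 An1 erefl nx _ _ Ly) => [z [/KL|->] //|{Ly}y].
(* Bilinearity replaces [x] by [x ^+ M], which lies in [A n]. For [y] in [K] its commutators with
   [K] are already in [K]; the extra factor [m] is spent when [y] is [g], to replace it by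
   [g ^+ m]. *)
case=> [Ky|->].
  have Ly := KL Ky; rewrite mulnC;
    apply: (pow_commXg_mod sL sA1 nA1 An1 erefl nx) => //.
  apply: (commMl_pow_mod sL sA1 nA1 An1 erefl Ly Sn _ AxM) => z zS.
  apply: (subgroupX _ sA1); case: zS => [[Kz nz]|nz].
    apply: KA; last exact: lcs_comm.
    by apply: subgroupM; [|exact: subgroupV|exact: subgroupJ].
  by apply: nA; apply: lcs_comm.
rewrite mulnC; apply: (pow_commXg_mod sL sA1 nA1 An1 erefl nx) => //.
apply: (commMl_pow_mod sL sA1 nA1 An1 erefl Lg Sn _ AxM) => z [[Kz nz]|nz].
  apply: (pow_commgX_mod sL sA1 nA1 An1 erefl nz) => //; apply: KA; last first.
    by apply: lcs_comm => //; apply: (subgroupX _ sL).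
  by apply: subgroupM; [|exact: subgroupV|exact: subgroupJ].
by apply: (subgroupX _ sA1); apply: nA; apply: lcs_comm.
Qed.

End Roots.

(** The lower central series of [L = <K, g>] is pushed into [K] from its trivial end up to [L]. Once
    [lcs L n.+1] is in [K], an [x] in [lcs L n] normalizes [K] and, by [lcs_root], has a positive
    power in [K], so the hypothesis applies to it. *)
Lemma isolated_of_normalizer K : nilpotent_group G -> subgroup K ->
  (forall g m, normalizer K g -> K (g ^+ m.+1) -> K g) ->
  forall g m, K (g ^+ m.+1) -> K g.
Proof.
move=> [c]; rewrite lower_central_lcs => c1 sK KN g m Kgm.
pose L := generated (K `|` [set g]).
have sL : subgroup L by exact: generated_subgroup.
have KL : K `<=` L by move=> x Kx; apply: sub_generated; left.
have Lg : L g by apply: sub_generated; right.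
suff: forall i, lcs L (c - i) `<=` K by move/(_ c g); rewrite subnn; apply.
elim=> [|i IH].
  rewrite subn0 => x /(lcs_mono (M := [set: G])) => /(_ (fun _ _ => I)).
  by rewrite c1 => ->; case: sK.
rewrite subnS; case: (c - i)%N IH => [//|n] nK x nx.
have Nx := lcs_normalizer sL sK KL nK nx.
have := lcs_root sK Kgm nx; rewrite -/L => Ax.
have pos : (0 < m.+1 ^ n.+1)%N by rewrite expn_gt0.
apply: (KN x (m.+1 ^ n.+1).-1 Nx); rewrite prednK //.
by move: Ax; apply: generated_min => // z [[]|/nK].
Qed.

End Isolators.

(** * Subspaces *)

Section Subspaces.
Local Open Scope ring_scope.
Variables (K : fieldType) (V : lmodType K).
Implicit Types (A B X Y Z Q : set V) (u v w x y : V) (a b c : K) (s t : seq V)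
  (l : seq (set V)).

Definition subspace X := X 0 /\ forall a u v, X u -> X v -> X (a *: u + v).

Lemma subspaceD X u v : subspace X -> X u -> X v -> X (u + v).
Proof. by case=> _ XP Xu Xv; rewrite -[u]scale1r; apply: XP. Qed.

Lemma subspaceZ X a u : subspace X -> X u -> X (a *: u).
Proof. by case=> X0 XP Xu; rewrite -[_ *: _]addr0; apply: XP. Qed.

Lemma subspaceN X u : subspace X -> X u -> X (- u).
Proof. by move=> sX Xu; rewrite -scaleN1r; apply: subspaceZ. Qed.

Lemma subspaceB X u v : subspace X -> X u -> X v -> X (u - v).
Proof. by move=> sX Xu Xv; apply: subspaceD => //; apply: subspaceN. Qed.

Lemma subspaceDl X u v : subspace X -> X u -> X (u + v) -> X v.
Proof. by move=> sX Xu Xuv; rewrite -(addKr u v) addrC; apply: subspaceB. Qed.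

Lemma subspace_sum X I (r : seq I) (F : I -> V) : subspace X ->
  (forall i, X (F i)) -> X (\sum_(i <- r) F i).
Proof.
by move=> sX XF; elim/big_rec: _ => [|i v _]; [case: sX|apply: subspaceD].
Qed.

Lemma subspaceI X Y : subspace X -> subspace Y -> subspace (X `&` Y).
Proof. by move=> [X0 XP] [Y0 YP]; split=> // a u v [? ?] [? ?]; split;
  auto.
Qed.

Definition lspan A : set V := [set v | forall X, subspace X -> A `<=` X -> X v].

Lemma lspan_subspace A : subspace (lspan A).
Proof.
split=> [X [] //|a u v Au Av X sX AX].
by case: (sX) => _; apply; [apply: Au|apply: Av].
Qed.

Lemma sub_lspan A : A `<=` lspan A. Proof. by move=> v Av X _; apply. Qed.

Lemma lspan_min A X : subspace X -> A `<=` X -> lspan A `<=` X.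
Proof. by move=> sX AX v; apply. Qed.

Lemma lspan_mono A B : A `<=` B -> lspan A `<=` lspan B.
Proof.
by move=> AB; apply: lspan_min; [exact: lspan_subspace|move=> v /AB;
  apply: sub_lspan].
Qed.

Lemma lspan_setU A B v : lspan (A `|` B) v ->
  exists2 a, lspan A a & exists2 b, lspan B b & v = a + b.
Proof.
have sA := lspan_subspace A; have sB := lspan_subspace B.
move/(_ [set v | exists2 a, lspan A a & exists2 b, lspan B b & v = a + b]);
  apply.
  split; first by exists 0; [case: sA|exists 0; [case: sB|rewrite addr0]].
  move=> c _ _ [x Ax [y By ->]] [x' Ax' [y' By' ->]].
  exists (c *: x + x'); first by case: sA => _; apply.
  exists (c *: y + y'); first by case: sB => _; apply.
  by rewrite scalerDr addrACA.
move=> u [Au|Bu]; first by exists u; [apply: sub_lspan|exists 0;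
  [case: sB|rewrite addr0]].
by exists 0; [case: sA|exists u; [apply: sub_lspan|rewrite add0r]].
Qed.

Lemma lspan0 v : lspan set0 v -> v = 0.
Proof.
by move/(_ [set 0]); apply=> //; split=> // a u w /= -> ->;
  rewrite scaler0 addr0.
Qed.

Lemma lspan_set1 u v : lspan [set u] v -> exists c, v = c *: u.
Proof.
move/(_ [set v | exists c, v = c *: u]); apply=> [|_ ->]; last by exists 1;
  rewrite scale1r.
split=> [|a _ _ [c ->] [d ->]]; first by exists 0; rewrite scale0r.
by exists (a * c + d); rewrite scalerDl scalerA.
Qed.

Definition line v : set V := [set c *: v | c in [set: K]].

Lemma subspace_line v : subspace (line v).
Proof.
split=> [|a _ _ [c _ <-] [d _ <-]]; first by exists 0 => //; rewrite scale0r.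
by exists (a * c + d) => //; rewrite scalerDl scalerA.
Qed.

Lemma line_in v : line v v. Proof. by exists 1 => //; rewrite scale1r. Qed.

Lemma lspan_cons v s u : lspan [set` v :: s] u ->
  exists c, exists2 w, lspan [set` s] w & u = c *: v + w.
Proof.
move=> us; have : lspan ([set v] `|` [set` s]) u.
  by move: us; apply: lspan_mono => x /=; rewrite inE => /predU1P[->|];
    [left|right].
by case/lspan_setU=> _ /lspan_set1[c ->] [w sw ->]; exists c, w.
Qed.

Lemma lspan_seq s v : lspan [set` s] v -> exists c : 'I_(size s) -> K, v =
  \sum_i c i *: s`_i.
Proof.
elim: s v => [|x s IH] v.
  rewrite set_nil => /lspan0 ->; exists (fun=> 0).
  by rewrite big1 // => i _; rewrite scale0r.
case/lspan_cons=> a [w /IH[c ->] ->] /=.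
exists (fun i => if unlift ord0 i is Some j then c j else a).
rewrite big_ord_recl unlift_none /=; congr (_ + _).
by apply: eq_bigr => i _; rewrite liftK.
Qed.

Definition findim X := exists s, X `<=` lspan [set` s].

Lemma findim_sub X Y : X `<=` Y -> findim Y -> findim X.
Proof. by move=> XY [s sY]; exists s => v /XY /sY. Qed.

(** The length of a spanning list stands in for the dimension in later inductions. A vector of [X]
    with nonzero coefficient at the head replaces the head; the tail is treated by induction on the
    intersection of [X] with its span. *)
Lemma lspan_size_lt s X : subspace X -> X `<=` lspan [set` s] ->
  lspan [set` s] `<=` X \/ exists2 t, (size t < size s)%N & X `<=` lspan [set`
    t].
Proof.
elim: s X => [|v s IH] X sX Xs.
  by left=> u; rewrite set_nil => /lspan0 ->; case: sX.
have ss := lspan_subspace [set` s].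
have [Xs'|] := pselect (X `<=` lspan [set` s]); first by right; exists s.
move=> /existsNP[x /not_implyP[Xx nsx]].
have [c [w sw xE]] := lspan_cons (Xs _ Xx).
have c0 : c != 0.
  by apply/eqP => c0; apply: nsx; rewrite xE c0 scale0r add0r.
have [sX'|[t ts Xt]] := IH _ (subspaceI sX ss) (fun _ => @proj2 _ _).
  have Xv : X v.
    have -> : v = c^-1 *: (x - w) by rewrite xE addrK scalerA mulVf // scale1r.
    by apply: subspaceZ => //; apply: subspaceB => //; case: (sX' w).
  by left=> _ /lspan_cons[d [u /sX'[Xu _] ->]]; case: sX => _; apply.
right; exists (x :: t); rewrite //= => y Xy.
have [d [u su yE]] := lspan_cons (Xs _ Xy).
have st := lspan_subspace [set` x :: t].
have -> : y = (d / c) *: x + (y - (d / c) *: x) by rewrite addrC subrK.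
apply: (subspaceD st); first by apply: (subspaceZ _ st); apply: sub_lspan;
  rewrite /= inE eqxx.
apply: (@lspan_mono [set` t]) => [z /= zt|];
  first by rewrite inE (zt : z \in t) orbT.
apply: Xt; split; first by apply: subspaceB => //; apply: subspaceZ.
rewrite yE xE scalerDr scalerA divfK // opprD addrACA subrr add0r.
by apply: (subspaceB ss) => //; apply: (subspaceZ _ ss).
Qed.

(** The coefficient matrix has more rows than columns, hence a nonzero row in its left kernel. *)
Lemma linear_dependence s n (t : 'I_n -> V) : (size s < n)%N ->
  (forall i, lspan [set` s] (t i)) ->
  exists2 c : 'I_n -> K, exists i, c i != 0 & \sum_i c i *: t i = 0.
Proof.
move=> sn ts.
have [A AE] : exists A : 'M[K]_(n, size s), forall i, t i = \sum_j A i j *: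
  s`_j.
  have [F FE] := choice (fun i => lspan_seq (ts i)).
  exists (\matrix_(i, j) F i j) => i; rewrite FE.
  by apply: eq_bigr => j _; rewrite mxE.
have kA : kermx A != 0.
  rewrite -mxrank_eq0 mxrank_ker subn_eq0 -ltnNge.
  exact: leq_ltn_trans (rank_leq_col A) sn.
have [i kAi] : exists i, row i (kermx A) != 0.
  apply/existsP; apply: contraNT kA => /existsPn kA0;
    apply/eqP/row_matrixP => i.
  by rewrite row0; apply/eqP; rewrite -[_ == _]negbK kA0.
exists (fun j => row i (kermx A) 0 j).
  apply/existsP; apply: contraNT kAi => /existsPn k0; apply/eqP/rowP => j.
  by rewrite [RHS]mxE; apply/eqP; rewrite -[_ == _]negbK k0.
have kA0 : row i (kermx A) *m A = 0 by rewrite -row_mul mulmx_ker row0.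
under eq_bigr do rewrite AE scaler_sumr.
rewrite exchange_big big1 //= => j _.
under eq_bigr do rewrite scalerA.
rewrite -scaler_suml; have /rowP/(_ j) := kA0; rewrite !mxE => ->.
by rewrite scale0r.
Qed.

Fixpoint lsum l : set V :=
  if l is Y :: l' then [set v | exists2 y, Y y & exists2 w, lsum l' w & v = y +
    w]
  else [set 0].

Lemma lsum_subspace l : (forall Y, Y \in l -> subspace Y) -> subspace (lsum l).
Proof.
elim: l => [_|Y l IH ls]; first by split=> //= a u v -> ->;
  rewrite scaler0 addr0.
have sY : subspace Y by apply: ls; rewrite inE eqxx.
have sl : subspace (lsum l) by apply: IH => Z Zl; apply: ls;
  rewrite inE Zl orbT.
split=> [|a _ _ [y Yy [w lw ->]] [y' Yy' [w' lw' ->]]].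
  by exists 0; [case: sY|exists 0; [case: sl|rewrite addr0]].
exists (a *: y + y'); first by case: sY => _; apply.
exists (a *: w + w'); first by case: sl => _; apply.
by rewrite scalerDr addrACA.
Qed.

Lemma sub_lsum l Y : (forall Y, Y \in l -> subspace Y) -> Y \in l ->
  Y `<=` lsum l.
Proof.
elim: l => // Z l IH ls; rewrite inE => /predU1P[->|Yl] v Yv.
  exists v => //; exists 0; last by rewrite addr0.
  by case: (@lsum_subspace l) => // T Tl; apply: ls; rewrite inE Tl orbT.
exists 0; first by case: (ls Z); rewrite // inE eqxx.
exists v; last by rewrite add0r.
by apply: IH => // T Tl; apply: ls; rewrite inE Tl orbT.
Qed.

Lemma lspan_lsum (F : set (set V)) v : (forall Y, F Y -> subspace Y) ->
  lspan [set v | exists2 Y, F Y & Y v] v -> exists2 l, (forall Y, Y \in l -> F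
    Y) & lsum l v.
Proof.
move=> sF; move/(_ [set v | exists2 l, (forall Y, Y \in l -> F Y) & lsum l v]);
  apply.
  split=> [|a u w [l lF lu] [m mF mw]]; first by exists [::].
  have lmF : forall Y, Y \in l ++ m -> F Y.
    by move=> Y; rewrite mem_cat => /orP[/lF|/mF].
  have slm : forall Y, Y \in l ++ m -> subspace Y by move=> Y /lmF/sF.
  exists (l ++ m) => //; have sl := lsum_subspace slm.
  have cat_sub (l1 l2 : seq (set V)) : (forall Y, Y \in l1 ++ l2 -> subspace Y)
    -> lsum l1 `<=` lsum (l1 ++ l2) /\ lsum l2 `<=` lsum (l1 ++ l2).
    elim: l1 => [s2|Y l1 IH s12]; first by split=> // x /= ->;
      case: (lsum_subspace s2).
    have [|IH1 IH2] := IH; first by move=> Z Zl; apply: s12;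
      rewrite inE Zl orbT.
    split=> x; first by move=> [y Yy [z /IH1 lz ->]]; exists y => //; exists z.
    move=> /IH2 lx; exists 0; first by case: (s12 Y); rewrite // inE eqxx.
    by exists x => //; rewrite add0r.
  have [lsub msub] := cat_sub _ _ slm.
  by case: sl => _; apply; [apply: lsub|apply: msub].
move=> u [Y FY Yu]; exists [:: Y]; first by move=> Z; rewrite inE => /eqP ->.
by exists u => //; exists 0; rewrite //= addr0.
Qed.

End Subspaces.

(** * Irreducible subspaces and their translates *)

Section SimpleSubspaces.
Local Open Scope ring_scope.
Variables (K : fieldType) (G : groupType) (V : lmodType K).
Variable pi : representation G V.
Implicit Types (H M N S : set G) (g h : G).
Implicit Types (X Y Z Q U W : set V) (u v w x y : V) (a b c : K) (l : seq (set
  V)).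

Lemma rep_actK g v : pi g (pi g^-1%g v) = v.
Proof. by rewrite -rep_actM mulgV rep_act1. Qed.

Lemma rep_actVK g v : pi g^-1%g (pi g v) = v.
Proof. by rewrite -rep_actM mulVg rep_act1. Qed.

Lemma rep_act_eq0 g v : (pi g v == 0) = (v == 0).
Proof.
apply/eqP/eqP => [gv|->]; last by rewrite linear0.
by rewrite -(rep_actVK g v) gv linear0.
Qed.

Definition stable H X := forall h x, H h -> X x -> X (pi h x).

Definition simple H X := [/\ subspace X, stable H X, exists2 x, X x & x != 0 &
  forall Y, subspace Y -> stable H Y -> Y `<=` X -> (exists2 y, Y y & y != 0) ->
    X `<=` Y].

(** The image of [X] under [g], written as a preimage under [g^-1] so that membership needs no
    witness. *)
Definition translate g X : set V := [set v | X (pi g^-1%g v)].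

Lemma translate_act g X x : translate g X (pi g x) <-> X x.
Proof. by rewrite /translate /= rep_actVK. Qed.

Lemma translate1 X : translate 1%g X = X.
Proof. by apply/funext => v; rewrite /translate /= invg1 rep_act1. Qed.

Lemma translateM g h X : translate (g * h)%g X = translate g (translate h X).
Proof. by apply/funext => v; rewrite /translate /= invgM rep_actM. Qed.

Lemma translateVK g X : translate g^-1%g (translate g X) = X.
Proof. by rewrite -translateM mulVg translate1. Qed.

Lemma translateK g X : translate g (translate g^-1%g X) = X.
Proof. by rewrite -translateM mulgV translate1. Qed.

Lemma translateS g X Y : X `<=` Y -> translate g X `<=` translate g Y.
Proof. by move=> XY v /XY. Qed.

Lemma translate_subspace g X : subspace X -> subspace (translate g X).
Proof.
move=> [X0 XP]; split=> [|a u v Xu Xv]; rewrite /translate /= ?linear0 //.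
by rewrite linearP; apply: XP.
Qed.

Lemma translate_stable H X g : subgroup H -> stable H X -> H g ->
  translate g X = X.
Proof.
move=> sH HX Hg; apply/seteqP; split=> v; last first.
  by apply: HX; apply: subgroupV.
by move/(HX g _ Hg); rewrite rep_actK.
Qed.

Lemma stable_translate N X g : subgroup (normalizer N) -> stable N X ->
  normalizer N g -> stable N (translate g X).
Proof.
move=> sNN NX gN h v Nh Xv; rewrite /translate /= -rep_actM.
suff -> : (g^-1 * h = (h ^ g) * g^-1)%g by rewrite rep_actM; apply: NX;
  rewrite ?gN.
by rewrite conjgE !mulgA mulgK.
Qed.

Lemma simple_translate N X g : normalizer N g -> simple N X -> simple N
  (translate g X).
Proof.
move=> gN [sX NX [x Xx x0] Xmin]; have sNN := normalizer_subgroup N.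
split; [exact: translate_subspace|exact: stable_translate| |].
  by exists (pi g x); [apply/translate_act|rewrite rep_act_eq0].
move=> Y sY NY Yg [y Yy y0]; rewrite -(translateK g Y); apply: translateS;
  apply: Xmin.
- exact: translate_subspace.
- by apply: stable_translate => //; apply: (subgroupV sNN).
- by rewrite -(translateVK g X); apply: translateS.
by exists (pi g^-1%g y); [apply/translate_act|rewrite rep_act_eq0].
Qed.

(** A morphism from [X] to [V] is a total function constrained only on [X]; subspaces thus need no
    types of their own. *)
Definition rhom H X (f : V -> V) :=
  (forall a u v, X u -> X v -> f (a *: u + v) = a *: f u + f v) /\
  (forall h u, H h -> X u -> f (pi h u) = pi h (f u)).

Lemma hom0 H X f : subspace X -> rhom H X f -> f 0 = 0.
Proof.
move=> [X0 _] [fl _]; apply: (addrI (f 0)); rewrite addr0.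
by have := fl 1 0 0 X0 X0; rewrite !scale1r addr0.
Qed.

Lemma homD H X f u v : rhom H X f -> X u -> X v -> f (u + v) = f u + f v.
Proof. by move=> [fl _] Xu Xv; have := fl 1 u v Xu Xv; rewrite !scale1r. Qed.

Lemma homZ H X f c u : subspace X -> rhom H X f -> X u -> f (c *: u) = c *: f u.
Proof.
move=> sX hf Xu; have [X0 _] := sX; have [fl _] := hf.
by have := fl c u 0 Xu X0; rewrite (hom0 sX hf) !addr0.
Qed.

Lemma homB H X f u v : subspace X -> rhom H X f -> X u -> X v ->
  f (u - v) = f u - f v.
Proof.
move=> sX hf Xu Xv; rewrite (homD hf) //; last exact: subspaceN.
by rewrite -scaleN1r (homZ _ sX hf) // scaleN1r.
Qed.

Lemma hom_sub H H' X X' f : H' `<=` H -> X' `<=` X -> rhom H X f ->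
  rhom H' X' f.
Proof.
move=> HH XX [fl fe]; split=> [a u v /XX Xu /XX Xv|h u /HH Hh /XX Xu];
  first exact: fl.
exact: fe.
Qed.

Lemma hom_image_subspace H X f : subspace X -> rhom H X f -> subspace (f @` X).
Proof.
move=> sX hf; split=> [|a _ _ [u Xu <-] [v Xv <-]].
  by exists 0; [case: sX|rewrite (hom0 sX hf)].
by exists (a *: u + v); [case: sX => _; apply|case: hf => ->].
Qed.

Lemma hom_image_stable H X f : stable H X -> rhom H X f -> stable H (f @` X).
Proof.
move=> HX [_ fe] h _ Hh [u Xu <-]; exists (pi h u); first exact: HX.
exact: fe.
Qed.

Lemma hom_comp H X Y f f' : rhom H X f -> rhom H Y f' -> (forall x, X x -> Y (f
  x)) -> rhom H X (f' \o f).
Proof.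
move=> [fl fe] [gl ge] fXY; split=> [a u v Xu Xv|h u Hh Xu] /=.
  by rewrite fl // gl //; apply: fXY.
by rewrite fe // ge //; apply: fXY.
Qed.

Lemma hom_conj N X f g : normalizer N g -> stable N X -> rhom N X f ->
  rhom N (translate g X) (fun v => pi g (f (pi g^-1%g v))).
Proof.
move=> gN NX [fl fe]; split=> [a u v Xu Xv|h u Nh Xu];
  first by rewrite linearP fl // linearP.
rewrite /= -[RHS]rep_actM conjgC rep_actM; congr (pi g _).
rewrite -fe ?gN // -!rep_actM; congr (f (pi _ u)).
by rewrite conjgE !mulgA mulgK.
Qed.

Lemma simple_hom_inj N X f : simple N X -> rhom N X f -> (exists2 x, X x & f x
  != 0) -> forall x, X x -> f x = 0 -> x = 0.
Proof.
move=> [sX NX _ Xmin] hf [x Xx fx0] y Xy fy0; apply: contrapT => /eqP y0.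
move/eqP: fx0; apply.
pose Y := [set z | X z /\ f z = 0].
suff : X `<=` Y by case/(_ x Xx).
apply: Xmin => [|h z Nh [Xz fz]|z []//|]; last by exists y.
- have [X0 XP] := sX; split=> [|a u v [Xu fu] [Xv fv]]; first by split=> //;
  apply: hom0 hf.
  by split; [apply: XP|case: hf => -> // _; rewrite fu fv scaler0 addr0].
- by split; [apply: NX|case: hf => _ ->; rewrite ?fz ?linear0].
Qed.

Lemma simple_hom_inv N X f : simple N X -> rhom N X f -> (exists2 x, X x & f x
  != 0) -> exists2 f', rhom N (f @` X) f' & forall x, X x -> f' (f x) = x.
Proof.
move=> siX hf nz; have [sX NX _ _] := siX;
  have finj := simple_hom_inj siX hf nz.
have /choice[f' f'P] y : exists z, (f @` X) y -> X z /\ f z = y.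
  have [[x Xx <-]|nXy] := pselect ((f @` X) y); first by exists x.
  by exists 0.
have f'K x : X x -> f' (f x) = x.
  move=> Xx; have [|Xy fy] := f'P (f x); first by exists x.
  by apply/subr0_eq/finj; [exact: subspaceB|rewrite (homB sX hf) // fy subrr].
exists f' => //; split=> [a _ _ [u Xu <-] [v Xv <-]|h _ Nh [u Xu <-]].
  by case: (hf) => fl _; rewrite -fl // !f'K //; case: sX => _; apply.
by case: (hf) => _ fe; rewrite -fe // !f'K //; apply: NX.
Qed.

Lemma simple_hom_surj N X Y f : simple N X -> simple N Y -> rhom N X f ->
  (forall x, X x -> Y (f x)) -> (exists2 x, X x & f x != 0) -> f @` X = Y.
Proof.
move=> [sX NX _ _] [_ _ _ Ymin] hf fXY [x Xx fx0]; apply/seteqP; split.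
  by move=> _ [u Xu <-]; apply: fXY.
apply: Ymin; [exact: hom_image_subspace hf|exact: hom_image_stable hf| |].
  by move=> _ [u Xu <-]; apply: fXY.
by exists (f x) => //; exists x.
Qed.

(* A subrepresentation Q meeting a finite sum of simple subspaces contains a
   "graph" over one of the summands. *)
Lemma lsum_simple_graph N l Q : subgroup N -> (forall Y, Y \in l -> simple N Y)
  -> subspace Q -> stable N Q -> (exists2 q, Q q & lsum l q /\ q != 0) ->
  exists Y m f, [/\ Y \in l, {subset m <= l}, ~ Y `<=` lsum m, rhom N Y f &
    [/\ forall y, Y y -> lsum m (f y), forall y, Y y -> Q (y + f y) &
        exists2 y, Y y & y + f y != 0]].
Proof.
move=> sN; elim: l => [_ _ _ [q _ [/= ->]]|Z l IH siZl sQ NQ [q Qq [lq q0]]].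
  by rewrite eqxx.
have sil Y : Y \in l -> simple N Y by move=> Yl; apply: siZl;
  rewrite inE Yl orbT.
have [sZ NZ _ Zmin] : simple N Z by apply: siZl; rewrite inE eqxx.
have ls Y : Y \in l -> subspace Y by case/sil.
have sl := lsum_subspace ls.
have Nl : stable N (lsum l).
  elim: (l) sil => [_ h x _ /= ->|Y m IHm sim h _ Nh [y Yy [w mw ->]]].
    by rewrite /= linear0.
  exists (pi h y); first by have [_ NY _ _] := sim Y (mem_head _ _); apply: NY.
  exists (pi h w); last by rewrite linearD.
  by apply: IHm => // T Tm; apply: sim; rewrite inE Tm orbT.
(* If [Q] meets the tail, induction applies. Otherwise each [z] in [Z] has at most one [w] in the
   tail with [z + w] in [Q], and simplicity of [Z] provides one for every [z]. *)
have [Ql|nQl] := pselect (exists2 q, Q q & lsum l q /\ q != 0).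
  have [Y [m [f [Yl ml nYm hf fP]]]] := IH sil sQ NQ Ql.
  exists Y, m, f; split=> //; first by rewrite inE Yl orbT.
  by move=> T /ml Tl; rewrite inE Tl orbT.
have Ql0 x : Q x -> lsum l x -> x = 0.
  by move=> Qx lx; apply: contrapT => /eqP x0; apply: nQl; exists x.
have nZl : ~ Z `<=` lsum l.
  move=> Zl; move/eqP: q0; apply; apply: Ql0 => //.
  by case: lq => z /Zl lz [w lw ->]; apply: subspaceD.
pose Z' := [set z | Z z /\ exists2 w, lsum l w & Q (z + w)].
have [z0 Zz0 [w0 lw0 qE]] := lq.
have ZZ' : Z `<=` Z'.
  apply: Zmin => [|h z Nh [Zz [w lw Qzw]]|z []//|].
  - split=> [|a u v [Zu [w lw Quw]] [Zv [w' lw' Qvw']]].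
      split; first by case: sZ.
      by exists 0; [case: sl|rewrite addr0; case: sQ].
    split; first by case: sZ => _; apply.
    exists (a *: w + w'); first by case: sl => _; apply.
    by rewrite addrACA -scalerDr; case: sQ => _; apply.
  - split; first exact: NZ.
    by exists (pi h w); [apply: Nl|rewrite -linearD; apply: NQ].
  exists z0; first by split=> //; exists w0; rewrite // -qE.
  by apply: contra_neq q0 => z00; apply: Ql0; rewrite // qE z00 add0r.
have /choice[f fP] z : exists w, Z z -> lsum l w /\ Q (z + w).
  have [/ZZ'[_ [w lw Qw]]|nZz] := pselect (Z z); first by exists w.
  by exists 0.
(* Uniqueness of the completion makes the chosen function [f] linear and equivariant. *)
have fU z w : Z z -> lsum l w -> Q (z + w) -> f z = w.
  move=> Zz lw Qzw; have [lf Qf] := fP z Zz.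
  apply/subr0_eq/Ql0; last exact: subspaceB.
  suff -> : f z - w = (z + f z) - (z + w) by apply: subspaceB.
  by rewrite opprD addrACA subrr add0r.
exists Z, l, f; split=> //; [by rewrite inE eqxx|by move=> T Tl;
  rewrite inE Tl orbT| |].
  split=> [a u v Zu Zv|h u Nh Zu].
    have [[lu Qu] [lv Qv]] := (fP u Zu, fP v Zv).
    apply: fU; [by case: sZ => _; apply|by case: sl => _; apply|].
    by rewrite addrACA -scalerDr; case: sQ => _; apply.
  have [lu Qu] := fP u Zu; apply: fU; [exact: NZ|exact: Nl|].
  by rewrite -linearD; apply: NQ.
split=> [z /fP[]//|z /fP[]//|].
by exists z0 => //; rewrite (fU z0 w0) -?qE.
Qed.

(** The graph found in [Q] is itself the image of a morphism, [y |-> y + f y], from a member of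
    [F]. *)
Lemma lspan_simple_hom N (F : set (set V)) Q : subgroup N ->
  (forall Y, F Y -> simple N Y) -> subspace Q -> stable N Q ->
  (exists2 q, Q q & lspan [set v | exists2 Y, F Y & Y v] q /\ q != 0) ->
  exists Y f, [/\ F Y, rhom N Y f, forall y, Y y -> Q (f y) & exists2 y, Y y &
    f y != 0].
Proof.
move=> sN siF sQ NQ [q Qq [Fq q0]].
have sF Y : F Y -> subspace Y by case/siF.
have [l lF lq] := lspan_lsum sF Fq.
have [|Y [m [f [Yl ml _ hf [_ fQ nz]]]]] :=
  lsum_simple_graph sN (fun Y Yl => siF Y (lF Y Yl)) sQ NQ.
  by exists q.
exists Y, (fun y => y + f y); split; [exact: lF| |exact: fQ|exact: nz].
have [fl fe] := hf; split=> [a u v Yu Yv|h u Nh Yu];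
  last by rewrite fe // linearD.
by rewrite fl // scalerDr addrACA.
Qed.

(** [S] is any set of elements: a subgroup gives the subrepresentation generated by [X], the
    complement of a subgroup gives the sum of the other translates. *)
Definition orbit_span S X := lspan [set v | exists2 g, S g & translate g X v].

Lemma orbit_span_translate S X g : S g -> translate g X `<=` orbit_span S X.
Proof. by move=> Sg v gv; apply: sub_lspan; exists g. Qed.

Lemma orbit_span_min S X Y : subspace Y -> (forall g, S g -> translate g X `<=`
  Y) -> orbit_span S X `<=` Y.
Proof. by move=> sY SY; apply: lspan_min => // v [g /SY]; apply. Qed.

Lemma orbit_span_subspace S X : subspace (orbit_span S X).
Proof. exact: lspan_subspace. Qed.

Lemma orbit_span_act S S' X h : (forall g, S g -> S' (h * g)%g) ->
  forall v, orbit_span S X v -> orbit_span S' X (pi h v).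
Proof.
move=> SS' v Sv.
suff : orbit_span S X `<=` translate h^-1%g (orbit_span S' X).
  by move/(_ v Sv); rewrite /translate /= invgK.
apply: orbit_span_min; first exact/translate_subspace/orbit_span_subspace.
move=> g /SS' S'hg u Xu; rewrite /translate /= invgK.
by apply: orbit_span_translate S'hg _ _; rewrite translateM;
  apply/translate_act.
Qed.

Lemma orbit_span_stable M X : subgroup M -> stable M (orbit_span M X).
Proof.
by move=> sM h v Mh; apply: orbit_span_act => g Mg; apply: subgroupM.
Qed.

Lemma orbit_span_sub M X : subgroup M -> X `<=` orbit_span M X.
Proof.
move=> [M1 _ _]; rewrite -{1}(translate1 X); exact: orbit_span_translate.
Qed.

(** Mackey's criterion for a normal subgroup: translates by different cosets are non-isomorphic
    simple [N]-subspaces. A nonzero [M]-stable [Q] contains the graph of a map from one translate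
    into a sum of others; that map must vanish, so [Q] contains the translate and hence all of
    them. *)
Lemma simple_orbit_span M N U : subgroup M -> subgroup N -> N `<=` M ->
  M `<=` normalizer N -> simple N U ->
  (forall g f, M g -> ~ N g -> rhom N U f -> (forall u, U u -> translate g U (f
    u)) -> forall u, U u -> f u = 0) ->
  simple M (orbit_span M U) /\
  (forall u, U u -> orbit_span (M `\` N) U u -> u = 0).
Proof.
move=> sM sN NM MN siU noniso; have [sU NU [u0 Uu0 u00] Umin] := siU.
have si g : M g -> simple N (translate g U) by move=> /MN gN;
  apply: simple_translate.
(* Conjugation by [g^-1] turns a map between two translates into one with source [U]. *)
have noniso2 g g' f : M g -> M g' -> ~ N (g^-1 * g')%g -> rhom N (translate g
  U) f -> (forall u, translate g U u -> translate g' U (f u)) ->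
    forall u, translate g U u -> f u = 0.
  move=> Mg Mg' Ngg' hf fg u gu.
  have gN : normalizer N g^-1%g by apply: MN; apply: (subgroupV sM).
  have := hom_conj gN (stable_translate (normalizer_subgroup N) NU (MN _ Mg))
    hf.
  rewrite translateVK => hf'.
  have := noniso _ _ _ Ngg' hf' _ (pi g^-1%g u).
  rewrite /= invgK rep_actK => H; apply/eqP; rewrite -(rep_act_eq0 g^-1%g).
  apply/eqP/H => //; first by apply: subgroupM => //; apply: subgroupV.
  move=> v Uv; rewrite translateM; apply/translate_act/fg.
  exact/translate_act.
split; last first.
  move=> u Uu Cu; apply: contrapT => /eqP un0.
  pose F := [set translate g U | g in M `\` N].
  have [||Y [f [[g [Mg Ng] <-] hf fU [y gy fy0]]]] := @lspan_simple_hom N F U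
    sN _ sU NU.
  - by move=> _ [g [Mg _] <-]; apply: si.
  - exists u => //; split=> //; apply: lspan_mono Cu => v [g MNg gv].
    by exists (translate g U) => //; exists g.
  move/eqP: fy0; apply; apply: (noniso2 g 1%g) gy => //.
  - by case: sM.
  - by rewrite mulg1 => /(subgroupVr sN).
  - by move=> v /fU; rewrite translate1.
split; [exact: orbit_span_subspace|exact: orbit_span_stable| |].
  by exists u0 => //; apply: orbit_span_sub.
move=> Q sQ MQ QU [q Qq q0].
suff [g Mg gQ] : exists2 g, M g & translate g U `<=` Q.
  apply: orbit_span_min => // g' Mg' v g'v.
  rewrite -(mulVKg g g') in g'v; rewrite -(rep_actK (g' * g^-1)%g v).
  apply: MQ; first by apply: subgroupM => //; apply: subgroupV.
  apply: gQ; rewrite /translate /= -rep_actM.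
  by rewrite invgM invgK !mulgA mulVg mul1g; move: g'v; rewrite mulVKg.
pose F := [set translate g U | g in M].
have Fq : lspan [set v | exists2 Y, F Y & Y v] q.
  apply: lspan_mono (QU _ Qq) => v [g Mg gv]; exists (translate g U) => //.
  by exists g.
have sF Y : F Y -> subspace Y by case=> g /si[? _ _ _] <-.
have [l lF lq] := lspan_lsum sF Fq.
have sil Y : Y \in l -> simple N Y by move=> /lF[g /si ? <-].
have NQ : stable N Q by move=> h x /NM; apply: MQ.
have [|Y [m [f [Yl ml nYm hf [fm fQ _]]]]] := lsum_simple_graph sN sil sQ NQ.
  by exists q.
have [g Mg gY] := lF _ Yl; exists g => //; rewrite gY.
have siY := sil _ Yl; have [sY NY _ _] := siY.
have [f0|nz] := pselect (forall y, Y y -> f y = 0).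
  by move=> y Yy; have := fQ y Yy; rewrite f0 // addr0.
have {}nz : exists2 y, Y y & f y != 0.
  by move: nz => /existsNP[y /not_implyP[Yy /eqP fy0]]; exists y.
(* A nonzero [f] is invertible on its image, which receives a nonzero map from some [Z] in [m]; the
   composite is a nonzero map from [Z] to [Y]. The cosets differ, since [Y] is not contained in the
   sum over [m]. *)
have sim Z : Z \in m -> simple N Z by move/ml/sil.
have [y Yy fy0] := nz.
have [|Z [m' [f' [Zm _ _ hf' [_ f'Q nz']]]]] :=
  lsum_simple_graph sN sim (hom_image_subspace sY hf) (hom_image_stable NY hf).
  by exists (f y); [exists y|split=> //; apply: fm].
have [fV hfV fVK] := simple_hom_inv siY hf nz.
have [g' Mg' g'Z] := lF _ (ml _ Zm).
exfalso.
have [z Zz fz0] := nz'; move/eqP: fz0; apply.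
have [x Yx fxE] := f'Q z Zz.
suff x0 : x = 0 by rewrite -fxE x0 (hom0 sY hf).
have hadd : rhom N Z (fun z => z + f' z).
  have [fl fe] := hf'; split=> [a u v Zu Zv|h u Nh Zu];
    last by rewrite fe // linearD.
  by rewrite fl // scalerDr addrACA.
have := noniso2 g' g (fV \o (fun z => z + f' z)) Mg' Mg.
rewrite gY g'Z => H; have := H _ (hom_comp hadd hfV f'Q) _ z Zz.
rewrite /= -fxE fVK //; apply.
  move=> Ng; apply: nYm.
  suff -> : Y = Z by apply: sub_lsum => // T Tm; case: (sim T Tm).
  rewrite -gY -g'Z -[g](mulVKg g') translateM.
  by rewrite (translate_stable sN NU Ng).
move=> v Zv; have [x' Yx' <-] := f'Q v Zv.
by rewrite fVK.
Qed.

End SimpleSubspaces.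

(** * Subgroups with a finite multiplicity *)

Section FiniteWeight.
Local Open Scope ring_scope.
Variables (K : fieldType) (G : groupType) (V : lmodType K).
Variable pi : representation G V.
Implicit Types (H M N S : set G) (g h : G).
Implicit Types (X Y Z Q U W E : set V) (u v w x y : V) (a b c : K) (s t : seq
  V).
Local Notation simple := (simple pi).
Local Notation stable := (stable pi).
Local Notation translate := (translate pi).
Local Notation rhom := (rhom pi).
Local Notation orbit_span := (orbit_span pi).

Lemma findim_translate g X : findim X -> findim (translate g X).
Proof.
move=> [s Xs]; exists (map (pi g) s) => v /Xs.
suff : lspan [set` s] `<=` translate g^-1%g (lspan [set` map (pi g) s]).
  by move=> sP /sP; rewrite /translate /= invgK rep_actK.
apply: lspan_min; first exact/translate_subspace/lspan_subspace.
by move=> u su; rewrite /translate /= invgK; apply: sub_lspan; apply: map_f.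
Qed.

Lemma findim_orbit_span S X (s : seq G) : findim X ->
  (forall g, S g -> exists2 h, h \in s & translate g X = translate h X) ->
  findim (orbit_span S X).
Proof.
move=> fX Ss.
have [t tP] : exists t, forall h, h \in s -> translate h X `<=` lspan [set` t].
  elim: s {Ss} => [|h s [t tP]]; first by exists [::].
  have [t' t'P] := findim_translate h fX; exists (t' ++ t) => k.
  rewrite inE => /predU1P[->|/tP kt].
    by apply: subset_trans t'P _; apply: lspan_mono => v /=;
      rewrite mem_cat => ->.
  by apply: subset_trans kt _; apply: lspan_mono => v /=;
    rewrite mem_cat orbC => ->.
exists t; apply: orbit_span_min; first exact: lspan_subspace.
by move=> g /Ss[h hs ->]; apply: tP.
Qed.

Lemma findim_seq X : subspace X -> findim X -> exists s, X = lspan [set` s].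
Proof.
move=> sX [s]; have [n] := ubnP (size s); elim: n s => // n IH s sn Xs.
have [sX'|[t ts Xt]] := lspan_size_lt sX Xs; first by exists s; apply/seteqP.
exact: IH (leq_trans ts _) Xt.
Qed.

Lemma simple_exists H X : subspace X -> stable H X -> findim X ->
  (exists2 x, X x & x != 0) -> exists2 W, simple H W & W `<=` X.
Proof.
move=> sX HX [s Xs]; have [n] := ubnP (size s).
elim: n s X sX HX Xs => // n IH s X sX HX Xs sn X0.
have [siX|nsiX] := pselect (simple H X); first by exists X.
have [Y [sY HY YX Y0 nXY]] : exists Y, [/\ subspace Y, stable H Y, Y `<=` X,
    (exists2 y, Y y & y != 0) & ~ X `<=` Y].
  apply: contrapT => nY; apply: nsiX; split=> // Y sY HY YX Y0.
  by apply: contrapT => nXY; apply: nY; exists Y.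
have Ys := subset_trans YX Xs.
have [sY'|[t ts Yt]] := lspan_size_lt sY Ys; first by case: nXY;
  apply: subset_trans sY'.
have [W siW WY] := IH t Y sY HY Yt (leq_trans ts sn) Y0.
by exists W => //; apply: subset_trans YX.
Qed.

Lemma simple_image H X f : simple H X -> rhom H X f -> (exists2 x, X x & f x !=
  0) -> simple H (f @` X).
Proof.
move=> siX hf nz; have [sX HX _ Xmin] := siX.
split; [exact: hom_image_subspace hf|exact: hom_image_stable hf| |].
  by have [x Xx fx0] := nz; exists (f x) => //; exists x.
move=> Y sY HY Yf [y Yy y0].
suff XY : X `<=` [set x | X x /\ Y (f x)] by move=> _ [x /XY[_ Yfx] <-].
apply: Xmin => [|h x Hh [Xx Yx]|x []//|].
- split=> [|a u v [Xu Yu] [Xv Yv]].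
    by split; [case: sX|rewrite (hom0 sX hf); case: sY].
  by split; [case: sX => _; apply|case: hf => -> // _; case: sY => _; apply].
- by split; [apply: HX|case: hf => _ -> //; apply: HY].
have [x Xx fxy] := Yf _ Yy; exists x; first by split=> //; rewrite fxy.
by apply: contra_neq y0 => x0; rewrite -fxy x0 (hom0 sX hf).
Qed.

(** For simple [W], the isotypic part of [V] of type [W] over [H]. *)
Definition hom_span H W :=
  lspan [set v | exists2 f, rhom H W f & exists2 w, W w & v = f w].

Lemma hom_span_hom H W f w : rhom H W f -> W w -> hom_span H W (f w).
Proof. by move=> hf Ww; apply: sub_lspan; exists f => //; exists w. Qed.

Lemma hom_id H W : rhom H W id. Proof. by []. Qed.

Lemma hom_span_sub H W : W `<=` hom_span H W.
Proof. by move=> w Ww; apply: (hom_span_hom (@hom_id H W)). Qed.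

Lemma hom_span_translate H W g : subgroup H -> stable H W -> normalizer H g ->
  translate g (hom_span H W) `<=` hom_span H (translate g W).
Proof.
move=> sH HW gN; rewrite -[X in _ `<=` X](translateK pi g); apply: translateS.
apply: lspan_min; first exact/translate_subspace/lspan_subspace.
move=> _ [f hf [w Ww ->]]; rewrite /translate /= invgK.
have := hom_span_hom (hom_conj gN HW hf) (iffRL (translate_act pi g W w) Ww).
by rewrite rep_actVK.
Qed.

Lemma hom_span_surj H W W' f : rhom H W f -> f @` W = W' ->
  hom_span H W' `<=` hom_span H W.
Proof.
move=> hf <-; apply: lspan_min; first exact: lspan_subspace.
move=> _ [f' hf' [_ [w Ww <-] ->]].
have hff' : rhom H W (f' \o f) by apply: hom_comp hf hf' _ => u Wu; exists u.
exact: (hom_span_hom hff' Ww).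
Qed.

(* Equivalently: W and Hom_H(W, V) are finite-dimensional. *)
Definition good H W := [/\ subgroup H, simple H W & findim (hom_span H W)].

(** Let [E'] be the [H']-span of the isotypic part, [U] simple over [H'] in [E'], and [X] simple
    over [H] in [U]. As [E'] is a sum of translates of images of [W], [X] is isomorphic to one of
    them, so every [H]-map sends [X] into [E']. The translates of [X] span [U], so every [H']-map
    sends [U] into [E']. *)
Lemma good_up H H' W : good H W -> subgroup H' -> H `<=` H' -> H' `<=`
  normalizer H ->
  findim (orbit_span H' (hom_span H W)) -> exists W', good H' W'.
Proof.
move=> [sH siW fE] sH' HH' H'N fE'.
set E := hom_span H W in fE fE' *; set E' := orbit_span H' E in fE' *.
have [sW HW [w0 Ww0 w00] Wmin] := siW.
have EE' : E `<=` E' by exact: orbit_span_sub.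
have H'E' : stable H' E' by apply: orbit_span_stable.
have [|U siU UE'] := simple_exists (orbit_span_subspace _ _ _) H'E' fE'.
  by exists w0 => //; apply: EE'; apply: hom_span_sub.
have [sU H'U U0 Umin] := siU.
have HU : stable H U by move=> h x /HH'; apply: H'U.
have [X siX XU] := simple_exists sU HU (findim_sub UE' fE') U0.
have [sX HX [x0 Xx0 x00] Xmin] := siX.
pose F := [set Y | exists g f, [/\ H' g, rhom H W f, exists2 w, W w & f w != 0 &
                                  Y = translate g (f @` W)]].
have siF Y : F Y -> simple H Y.
  by move=> [g [f [/H'N gN hf nz ->]]]; apply: simple_translate => //;
    apply: simple_image.
have E'F : E' `<=` lspan [set v | exists2 Y, F Y & Y v].
  apply: orbit_span_min => [|g H'g]; first exact: lspan_subspace.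
  rewrite -[X in _ `<=` X](translateK pi g); apply: translateS.
  apply: lspan_min; first exact/translate_subspace/lspan_subspace.
  move=> _ [f hf [w Ww ->]]; rewrite /translate /= invgK.
  have [->|fw0] := eqVneq (f w) 0; first by rewrite linear0;
    case: (lspan_subspace [set v | exists2 Y, F Y & Y v]).
  apply: sub_lspan; exists (translate g (f @` W)); last by apply/translate_act;
    exists w.
  by exists g, f; split=> //; exists w.
have [|Y [th [FY hth thX nz]]] := lspan_simple_hom sH siF sX HX.
  by exists x0 => //; split=> //; apply: E'F; apply: UE'; apply: XU.
have thYX := simple_hom_surj (siF _ FY) siX hth thX nz.
have [g [f [H'g hf _ YE]]] := FY; rewrite {}YE in hth thX thYX {nz FY}.
exists U; split=> //; apply: findim_sub fE'.
apply: lspan_min; first exact: orbit_span_subspace.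
move=> _ [f' hf' [u Uu ->]].
(* [th] maps a translate by [g] of f(W) onto [X]; composing with [f'] and conjugating back by [g]
   yields an [H]-map out of [W], whose values lie in [E]. *)
have XE' x : X x -> E' (f' x).
  move=> Xx; have [y] : (th @` translate g (f @` W)) x by rewrite thYX.
  move=> gy thy; have [w Ww fwy] := gy.
  suff : E (pi g^-1%g (f' x)) by apply: orbit_span_translate.
  have gVN : normalizer H g^-1%g by apply: H'N; apply: (subgroupV sH').
  have hf'X : rhom H X f' by apply: hom_sub hf'.
  have hf'th := hom_comp hth hf'X thX.
  have HfW : stable H (translate g (f @` W)).
    apply: stable_translate; [exact: normalizer_subgroup| |exact: H'N].
    exact: hom_image_stable hf.
  have := hom_conj gVN HfW hf'th; rewrite translateVK => hc.
  have hcf := hom_comp hf hc (fun z Wz => ex_intro2 _ _ z Wz erefl).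
  have := hom_span_hom hcf Ww; rewrite /= fwy invgK rep_actK thy; exact.
suff : U `<=` [set u | U u /\ E' (f' u)] by case/(_ u Uu).
have sE' : subspace E' by exact: orbit_span_subspace.
apply: subset_trans (Umin _ (orbit_span_subspace pi H' X) _ _ _) _.
- exact: orbit_span_stable.
- apply: orbit_span_min => // h H'h v Xv; rewrite -(rep_actK pi h v).
  by apply: H'U => //; apply: XU.
- by exists x0 => //; move: x0 Xx0 {x00}; apply: orbit_span_sub.
apply: orbit_span_min.
  split=> [|a v w [Uv Ev] [Uw Ew]].
    by split; [case: sU|rewrite (hom0 sU hf'); case: sE'].
  by split; [case: sU => _; apply|case: hf' => -> // _; case: sE' => _; apply].
move=> h H'h v Xv; rewrite -(rep_actK pi h v); split.
  by apply: H'U => //; apply: XU.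
case: hf' => _ ->//; last exact: XU.
by apply: H'E' => //; apply: XE'.
Qed.

(** * Consequences of the maximality of the subgroup *)

Section Maximal.
Variables (H : set G) (W : set V).
Hypothesis goodHW : good H W.
Hypothesis maxH : forall H' W', good H' W' -> H `<=` H' -> H' = H.
Let sH : subgroup H. Proof. by case: goodHW. Qed.
Let siW : simple H W. Proof. by case: goodHW. Qed.
Let sNH := normalizer_subgroup H.

Let maximal_normalizer g : normalizer H g ->
  findim (orbit_span (generated (H `|` [set g])) (hom_span H W)) -> H g.
Proof.
move=> gN fE; pose H' := generated (H `|` [set g]).
have sH' : subgroup H' by exact: generated_subgroup.
have HH' : H `<=` H' by move=> h Hh; apply: sub_generated; left.
have H'N : H' `<=` normalizer H.
  by apply: generated_min => // x [|->//]; apply: sub_normalizer.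
have [W' goodW'] := good_up goodHW sH' HH' H'N fE.
by rewrite -(maxH goodW' HH'); apply: sub_generated; right.
Qed.

Let E := hom_span H W.

Let EH h g : H h -> translate (g * h)%g E = translate g E.
Proof.
move=> Hh; rewrite translateM (translate_stable sH _ Hh) // => k x Hk Ex.
have [_ HW _ _] := siW.
suff : E `<=` translate k^-1%g E by move/(_ x Ex); rewrite /translate /= invgK.
apply: lspan_min; first exact/translate_subspace/lspan_subspace.
move=> _ [f hf [w Ww ->]]; rewrite /translate /= invgK.
by have [_ <- //] := hf; apply: hom_span_hom => //; apply: HW.
Qed.

(** Translates of [E] depend only on the coset modulo [H], so those by [g ^+ i] with [i <= m]
    exhaust the translates under [<H, g>]. *)
Lemma maximal_root g m : normalizer H g -> H (g ^+ m.+1)%g -> H g.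
Proof.
move=> gN Hgm; apply: maximal_normalizer => //.
have [_ _ fE] := goodHW.
apply: (@findim_orbit_span _ _ [seq (g ^+ i)%g | i <- iota 0 m.+1] fE) => x gx.
have Hgmq q : H (g ^+ (m.+1 * q))%g by rewrite expgnA; apply: (subgroupX _ sH).
have pow_mod n : exists2 h, h \in [seq (g ^+ i)%g | i <- iota 0 m.+1] &
    translate (g ^+ n)%g E = translate h E.
  exists (g ^+ (n %% m.+1))%g; first by apply: map_f; rewrite mem_iota ltn_mod.
  by rewrite {1}(divn_eq n m.+1) addnC expgnDr mulnC EH.
have HJ (y : G) : H y -> H (y ^ g)%g /\ H (y ^ g^-1)%g.
  by move=> Hy; split; [rewrite gN|rewrite (subgroupV sNH gN)].
have HJX (y : G) n : H y -> H (y ^ (g ^+ n))%g.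
  by move=> Hy; rewrite (subgroupX n sNH gN).
have [n [y Hy [->|]]] := generated_cyclic sH HJ gx.
  by rewrite conjgC EH; [exact: pow_mod|exact: HJX].
move=> xE; have -> : x = (g ^- n * y^-1)%g by rewrite -invgM -xE invgK.
rewrite EH; last exact: subgroupV.
(* A negative power is a natural one up to a power of [g ^+ m.+1], which is in [H]. *)
have -> : (g ^- n = g ^+ (m * n) * (g ^+ (m.+1 * n))^-1)%g.
  by rewrite mulSn expgnDr invgM mulVKg.
by rewrite EH; [exact: pow_mod|apply: subgroupV].
Qed.

(** If [W] is isomorphic to its translate by [g], then [E] equals its own translate, hence is
    already stable under [<H, g>]. *)
Lemma maximal_not_iso g f : normalizer H g -> rhom H W f ->
  (forall w, W w -> translate g W (f w)) -> (exists2 w, W w & f w != 0) -> H g.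
Proof.
move=> gN hf fg nz; apply: maximal_normalizer => //.
have [_ _ fE] := goodHW; apply: (findim_sub _ fE).
have [sW HW _ _] := siW.
have siG := simple_translate gN siW.
have fWg := simple_hom_surj siW siG hf fg nz.
have [f' hf' f'K] := simple_hom_inv siW hf nz; rewrite fWg in hf'.
have f'W : f' @` translate g W = W.
  rewrite -fWg; apply/seteqP; split=> [_ [_ [w Ww <-] <-]|w Ww];
    first by rewrite f'K.
  by exists (f w); [exists w|rewrite f'K].
have gE : translate g E = E.
  apply/seteqP; split.
    by apply: subset_trans (hom_span_translate sH HW gN) (hom_span_surj hf fWg).
  rewrite -{1}(translateK pi g E); apply: translateS.
  have gVN : normalizer H g^-1%g by apply: (subgroupV sNH).
  apply: subset_trans (translateS (hom_span_surj hf' f'W)) _.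
  have Hg : stable H (translate g W) by case: siG.
  by have := hom_span_translate sH Hg gVN; rewrite translateVK.
apply: orbit_span_min; first exact: lspan_subspace.
move=> x gx; suff -> : translate x E = E by [].
suff : generated (H `|` [set g]) `<=` [set x | translate x E = E] by apply.
apply: generated_min => [|y [Hy|->]//=].
- split=> [|y z /= yE zE|y /= yE]; first exact: translate1.
    by rewrite translateM zE.
  by rewrite -{1}yE translateVK.
- by rewrite /= -(mul1g y) EH // translate1.
Qed.

End Maximal.
End FiniteWeight.

(** * Climbing the chain of normalizers *)

Section Chain.
Local Open Scope ring_scope.
Variables (K : fieldType) (G : groupType) (V : lmodType K).
Variable pi : representation G V.
Implicit Types (H M N S : set G) (g h x y z : G).
Implicit Types (X Y Z Q U W E : set V) (u v w : V) (a b c : K) (t : seq V).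
Local Notation simple := (simple pi).
Local Notation stable := (stable pi).
Local Notation translate := (translate pi).
Local Notation rhom := (rhom pi).
Local Notation orbit_span := (orbit_span pi).

(* For W stable under H, this says that the translates of W indexed by M / H
   are in direct sum: only the summand of the trivial coset has to be tested. *)
Definition direct M H W := forall u, W u -> orbit_span (M `\` H) W u -> u = 0.

Lemma orbit_span_trans M M' W : subgroup M -> subgroup M' -> M `<=` M' ->
  orbit_span M' (orbit_span M W) = orbit_span M' W.
Proof.
move=> sM sM' MM'; apply/seteqP; split; apply: orbit_span_min => [|g M'g];
  try exact: lspan_subspace.
  rewrite -[X in _ `<=` X](translateK pi g); apply: translateS.
  apply: orbit_span_min; first exact/translate_subspace/lspan_subspace.
  move=> h Mh v hv; rewrite /translate /= invgK.
  have M'gh : M' (g * h)%g by apply: subgroupM => //; apply: MM'.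
  apply: (orbit_span_translate M'gh).
  by rewrite translateM; apply/translate_act.
apply: subset_trans _ (orbit_span_translate M'g).
by apply: translateS; apply: orbit_span_sub.
Qed.

Lemma orbit_span_setU S S' W v : orbit_span (S `|` S') W v ->
  exists2 a, orbit_span S W a & exists2 b, orbit_span S' W b & v = a + b.
Proof.
move=> Sv; apply: lspan_setU; move: Sv; apply: lspan_mono => u [g [Sg|S'g] gu].
  by left; exists g.
by right; exists g.
Qed.

Lemma orbit_span_mono S S' X Y : S `<=` S' -> X `<=` Y ->
  orbit_span S X `<=` orbit_span S' Y.
Proof.
by move=> SS XY; apply: lspan_mono => v [g /SS Sg /(translateS XY) gv];
  exists g.
Qed.

Lemma orbit_span_set0 W v : orbit_span set0 W v -> v = 0.
Proof.
move=> v0; apply: lspan0; move: v0; apply: lspan_mono; by move=> u [].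
Qed.

(** Transitivity of induction: the part of a relation over [M'] outside [M] vanishes by directness
    over [M], leaving a relation inside [M]. *)
Lemma direct_trans H M M' W : subgroup M -> H `<=` M -> M `<=` M' ->
  direct M H W -> direct M' M (orbit_span M W) -> direct M' H W.
Proof.
move=> sM HM MM' dMH dM'M u Wu.
have -> : M' `\` H = (M `\` H) `|` (M' `\` M).
  apply/seteqP; split=> g; last first.
    by case=> [[Mg Hg]|[M'g Mg]]; split=> //; [apply: MM'|move/HM].
  by case=> M'g Hg; have [Mg|Mg] := pselect (M g); [left|right].
move=> /orbit_span_setU[a Ca [b Cb uE]].
have WU : W `<=` orbit_span M W by exact: orbit_span_sub.
have sU := orbit_span_subspace pi M W.
have Ua : orbit_span M W a by move: Ca; apply: orbit_span_mono => // g [].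
have b0 : b = 0.
  apply: dM'M; last by move: Cb; apply: orbit_span_mono.
  by apply: (subspaceDl sU Ua); rewrite -uE; apply: WU.
by apply: dMH => //; rewrite uE b0 addr0.
Qed.

(** For [x] in [M], the translate by [x] of the span over the complement of [H] is the sum of all
    translates by cosets other than that of [x]. Membership thus expresses a vanishing component at
    [x], and a vector has only finitely many others. *)
Lemma finite_support M H W v : subgroup M -> orbit_span M W v ->
  exists s : seq G, forall x, M x -> (forall z, z \in s -> ~ H (x^-1 * z)%g) ->
    translate x (orbit_span (M `\` H) W) v.
Proof.
move=> sM; set C := orbit_span (M `\` H) W.
have sC x : subspace (translate x C) by apply/translate_subspace/lspan_subspace.
pose X := [set v | exists s : seq G, forall x, M x ->
  (forall z, z \in s -> ~ H (x^-1 * z)%g) -> translate x C v].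
move=> Mv; suff : orbit_span M W `<=` X by move/(_ v Mv).
apply: lspan_min.
  split=> [|a u w [s sP] [t tP]]; first by exists [::] => x _ _; case: (sC x).
  exists (s ++ t) => x Mx xP; case: (sC x) => _; apply.
    by apply: sP => // z zs; apply: xP; rewrite mem_cat zs.
  by apply: tP => // z zs; apply: xP; rewrite mem_cat zs orbT.
move=> u [z Mz zu]; exists [:: z] => x Mx xP.
have xzM : (M `\` H) (x^-1 * z)%g.
  split; first by apply: subgroupM => //; apply: subgroupV.
  by apply: xP; rewrite inE.
rewrite /translate /=; apply: (orbit_span_translate xzM).
by rewrite translateM; apply/translate_act.
Qed.

Lemma finite_support_seq M H W t : subgroup M -> [set` t] `<=` orbit_span M W ->
  exists s : seq G, forall x, M x -> (forall z, z \in s -> ~ H (x^-1 * z)%g) ->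
    lspan [set` t] `<=` translate x (orbit_span (M `\` H) W).
Proof.
move=> sM; elim: t => [_|v t IH tM].
  exists [::] => x _ _ w; rewrite set_nil => /lspan0 ->.
  by case: (translate_subspace pi x (orbit_span_subspace pi (M `\` H) W)).
have [|s sP] := IH; first by move=> w wt; apply: tM;
  rewrite /= inE (wt : w \in t) orbT.
have [s' s'P] := finite_support H sM (tM v (mem_head _ _)).
exists (s' ++ s) => x Mx xP _ /lspan_cons[c [w tw ->]].
case: (translate_subspace pi x (orbit_span_subspace pi (M `\` H) W)) => _;
  apply.
  by apply: s'P => // z zs; apply: xP; rewrite mem_cat zs.
by apply: sP tw => // z zs; apply: xP; rewrite mem_cat zs orbT.
Qed.

Lemma findim_image H W f : subspace W -> rhom H W f -> findim W ->
  findim (f @` W).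
Proof.
move=> sW hf fW; have [s WE] := findim_seq sW fW; exists (map f s).
move=> _ [w Ww <-]; suff : W `<=` [set w | W w /\ lspan [set` map f s] (f w)].
  by case/(_ w Ww).
have ss := lspan_subspace [set` map f s].
rewrite [X in X `<=` _]WE; apply: lspan_min.
  split=> [|a u v [Wu fu] [Wv fv]].
    by split; [case: sW|rewrite (hom0 sW hf); case: ss].
  by split; [case: sW => _; apply|case: hf => -> // _; case: ss => _; apply].
move=> u su; split; first by rewrite WE; apply: sub_lspan.
by apply: sub_lspan; apply: map_f.
Qed.

Lemma pigeonhole_seq (T : eqType) (s : seq T) (f : nat -> T) :
  (forall n, f n \in s) -> exists n m, (n < m)%N /\ f n = f m.
Proof.
move=> fs; set r := map f (iota 0 (size s).+1).
have : ~~ uniq r.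
  apply/negP => ur; have rs : {subset r <= s} by move=> _ /mapP[i _ ->].
  by have := uniq_leq_size ur rs; rewrite size_map size_iota ltnn.
case/(uniqPn (f 0%N)) => i [j [ij]]; rewrite size_map size_iota => js E.
exists i, j; split=> //; move: E.
by rewrite !(nth_map 0%N) ?size_iota ?(ltn_trans ij) // !nth_iota // (ltn_trans
  ij).
Qed.

(** Closure under roots shows that conjugation by [y] sends [H] into [H]. The preimages of [H] under
    conjugation by [y ^+ k] then increase with [k], and the maximal condition forces equality.
    Contrapositively, if [y] does not normalize [H], some [h] in [H] has no positive power fixing
    the coset [y H]. *)
Lemma infinite_orbits H y : finitely_generated G -> nilpotent_group G ->
  subgroup H -> (forall g m, H (g ^+ m.+1)%g -> H g) ->
  (forall h, H h -> exists m, H ((h ^ y) ^+ m.+1)%g) -> normalizer H y.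
Proof.
move=> fgG nilG sH isoH Hy.
have HJ h : H h -> H (h ^ y)%g by move=> /Hy[m /isoH].
pose F := [set A : set G | exists k, A = [set z | H (z ^ (y ^+ k))%g]].
have sF A : F A -> subgroup A.
  move=> [k ->]; split=> [|u v Hu Hv|u Hu] /=.
  - by rewrite conj1g; case: sH.
  - by rewrite conjMg; apply: subgroupM.
  - by rewrite conjVg; apply: subgroupV.
have F0 : exists A, F A by eexists; exists 0%N.
have [A [k AE] Amax] := maximal_condition fgG nilG sF F0.
have AS := Amax [set z | H (z ^ (y ^+ k.+1))%g] (ex_intro _ k.+1 erefl).
move=> h; split; last exact: HJ.
move=> Hhy; have : A (h ^ (y ^- k))%g.
  rewrite -AS /=; first by rewrite expgSr conjgM conjgKV.
  by move=> z; rewrite AE /= expgSr conjgM; apply: HJ.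
by rewrite AE /= conjgKV.
Qed.

Section Step.
Variables (H : set G) (W : set V).
Hypotheses (fgG : finitely_generated G) (nilG : nilpotent_group G).
Hypotheses (sH : subgroup H) (siW : simple H W) (fW : findim W).
Hypothesis isoH : forall g m, H (g ^+ m.+1)%g -> H g.

(* A finite-dimensional H-subspace of g U_M would have finite support on the
   cosets of H, but each element g x lies outside the normalizer of H, hence
   has an infinite H-orbit of cosets. *)
Lemma chain_not_iso M g f : subgroup M -> normalizer H `<=` M -> H `<=` M ->
  simple M (orbit_span M W) -> direct M H W -> normalizer M g -> ~ M g ->
  rhom M (orbit_span M W) f ->
  (forall u, orbit_span M W u -> translate g (orbit_span M W) (f u)) ->
  forall u, orbit_span M W u -> f u = 0.
Proof.
move=> sM NM HM; set U := orbit_span M W; set C := orbit_span (M `\` H) W.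
move=> siU dM gN Mg hf fg u0 Uu0; apply: contrapT => /eqP fu0.
have nz : exists2 u, U u & f u != 0 by exists u0.
have finj := simple_hom_inj siU hf nz.
have [sW HW [w Ww w0] _] := siW; have [sU MU _ Umin] := siU.
have WU : W `<=` U by exact: orbit_span_sub.
have hfW : rhom H W f by apply: hom_sub hf.
(* Moved back by [g^-1], the image f(W) is a finite-dimensional subspace of [U] itself, stable under
   all [h ^ g] with [h] in [H]. *)
pose X := translate g^-1%g (f @` W).
have sX : subspace X by apply/translate_subspace/(hom_image_subspace sW hfW).
have XU : X `<=` U.
  move=> v [w' Ww' fw']; have := fg w' (WU _ Ww').
  by rewrite fw' invgK; move/translate_act.
have XJ h v : H h -> X v -> X (pi (h ^ g)%g v).
  move=> Hh [w' Ww' fw']; exists (pi h w'); first exact: HW.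
  have [_ -> //] := hfW; rewrite fw' invgK -!rep_actM; congr (pi _ v).
  by rewrite conjgE !mulgA mulgV mul1g.
have fX : findim X.
  by apply: findim_translate; apply: findim_image hfW fW.
pose u := pi g^-1%g (f w).
have Xu : X u by exists w => //; rewrite invgK rep_actK.
have u_neq0 : u <> 0.
  move/eqP; rewrite rep_act_eq0 => /eqP /finj.
  by move/(_ (WU _ Ww)) => w00; rewrite w00 eqxx in w0.
have sC x : subspace (translate x C) by apply/translate_subspace/lspan_subspace.
(* [x] is a coset at which [u] has a nonzero component: the vectors of [U] without any form an
   [M]-stable subspace, which is not [U] because [W] meets [C] in 0. *)
have [x Mx nxu] : exists2 x, M x & ~ translate x C u.
  apply: contrapT => nx; pose D := [set v | U v /\ forall x, M x -> translate x
    C v].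
  have UD : U `<=` D.
    apply: Umin => [|h v Mh [Uv vD]|v []//|].
    - split; first by split=> [|x _]; [case: sU|case: (sC x)].
      move=> a v v' [Uv vD] [Uv' v'D]; split; first by case: sU => _; apply.
      by move=> x Mx; case: (sC x) => _; apply; [apply: vD|apply: v'D].
    - split=> [|x Mx]; first exact: MU.
      apply/(translate_act pi h^-1%g); rewrite -translateM rep_actVK.
      by apply: vD; apply: subgroupM => //; apply: subgroupV.
    exists u; last exact/eqP.
    by split=> [|x Mx]; [apply: XU|apply: contrapT => nxu; apply: nx; exists x].
  have [_ /(_ 1%g)] := UD _ (WU _ Ww); rewrite translate1 => wC.
  have /dM-/(_ Ww) w00 := wC (let: And3 H1 _ _ := sM in H1).
  by rewrite w00 eqxx in w0.
(* Otherwise [g * x] would normalize [H], hence lie in [M], and [g] with it. *)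
have [h Hh nh] : exists2 h, H h & forall m, ~ H ((h ^ (g * x)) ^+ m.+1)%g.
  apply: contrapT => nh; apply: Mg; suff /NM : normalizer H (g * x)%g.
    by move/(subgroupMr _ sM Mx).
  apply: infinite_orbits => // h Hh; apply: contrapT => nm; apply: nh.
  by exists h => // m Hm; apply: nm; exists m.
pose k := (h ^ g)%g.
have Mk : M k by rewrite gN; apply: HM.
have [t XE] := findim_seq sX fX.
have [|s sP] := @finite_support_seq M H W t sM.
  by move=> v vt; apply: XU; rewrite XE; apply: sub_lspan.
rewrite -XE in sP.
(* Acting by [k ^+ m] carries the nonzero component of [u] to the coset of [k ^+ m * x], which must
   be one of the finitely many in [s]. Two equal cosets then put a positive power of [h ^ (g * x)]
   in [H]. *)
have /choice[F FP] m : exists z, z \in s /\ H ((k ^+ m * x)^-1 * z)%g.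
  apply: contrapT => nz'; have Mkx : M (k ^+ m * x)%g.
    by apply: subgroupM => //; apply: (subgroupX _ sM).
  have Xkm : X (pi (k ^+ m)%g u).
    elim: m {nz' Mkx} => [|m IH]; first by rewrite rep_act1.
    by rewrite expgS rep_actM; apply: XJ.
  apply: nxu; apply/(translate_act pi (k ^+ m)%g); rewrite -translateM.
  by apply: sP Xkm => // z zs Hz; apply: nz'; exists z.
have [n [m [lt_nm Fnm]]] := pigeonhole_seq (fun n => (FP n).1).
have [_ Hn] := FP n; have [_ Hm] := FP m.
apply: (nh (m - n).-1); rewrite prednK ?subn_gt0 // conjgM -/k -conjXg.
rewrite expgnFr; last exact: ltnW.
have -> : (k ^+ m / k ^+ n = k ^- n * k ^+ m)%g by apply/commuteV/commuteX2.
have := subgroupM sH Hn (subgroupV sH Hm); rewrite Fnm conjgE.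
by rewrite !invgM !invgK !mulgA mulgK.
Qed.
End Step.

(** Maximality is taken over subgroups admitting some good subspace, since enlarging the subgroup
    changes [W]. *)
Lemma finite_weight_monomial_support H W : finitely_generated G ->
  nilpotent_group G ->
  good pi H W -> exists H' W', [/\ subgroup H', simple H' W', findim W' &
    direct setT H' W'].
Proof.
move=> fgG nilG goodHW.
pose F := [set A | exists W, good pi A W].
have sF A : F A -> subgroup A by case=> ? [].
have [H' [W' good'] maxF] := maximal_condition fgG nilG sF (ex_intro _ H
  (ex_intro _ W goodHW)).
have maxH : forall A B, good pi A B -> H' `<=` A -> A = H'.
  by move=> A B gAB; apply: maxF; exists B.
have [sH' siW' fE] := good'.
have fW' : findim W' by apply: findim_sub fE; apply: hom_span_sub.
exists H', W'; split=> //.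
have isoH : forall g m, H' (g ^+ m.+1)%g -> H' g.
  by apply: isolated_of_normalizer => // g m; apply: (maximal_root good' maxH).
have sN := iter_normalizer_subgroup _ sH'.
have HN n : H' `<=` iter_normalizer H' n.
  elim: n => //= n IH; apply: subset_trans IH _; exact: sub_normalizer.
suff chain n : simple (iter_normalizer H' n) (orbit_span (iter_normalizer H' n)
  W') /\
    direct (iter_normalizer H' n) H' W'.
  by have [n nT] := iter_normalizer_full nilG sH'; have [_] := chain n;
    rewrite nT.
have [sW HW _ _] := siW'.
have HW' : orbit_span H' W' = W'.
  apply/seteqP; split; last exact: orbit_span_sub.
  by apply: orbit_span_min => // g Hg; rewrite (translate_stable sH').
have NH m : normalizer H' `<=` iter_normalizer H' m.+1.
  by elim: m => //= m IH; apply: subset_trans IH _; apply: sub_normalizer;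
    apply: (sN m.+1).
elim: n => [|n [IHs IHd]].
  by rewrite /= HW'; split=> // u _; rewrite setDv => /orbit_span_set0.
have NN := sub_normalizer (sN n).
have [||s' d'] := simple_orbit_span (sN n.+1) (sN n) NN _ IHs.
- by [].
(* At the bottom the subgroup is [H'], which need not contain its normalizer as [chain_not_iso]
   requires; there maximality excludes isomorphic translates. *)
- case: n IHs IHd NN => [|n] IHs IHd NN g f gN ng hf fg.
    rewrite /= HW' in hf fg * => u Wu; apply: contrapT => /eqP fu0.
    by apply: ng; apply: (maximal_not_iso good' maxH gN hf fg); exists u.
  exact: (chain_not_iso fgG nilG sH' siW' fW' isoH (sN n.+1) (NH n) (HN _) IHs
    IHd gN ng hf fg).
split; last exact: direct_trans (sN n) (HN n) NN IHd d'.
by rewrite -(orbit_span_trans _ (sN n) (sN n.+1) NN).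
Qed.


End Chain.

(** * Polynomials in an operator *)

Section OperatorPolynomials.
Local Open Scope ring_scope.
Variables (K : fieldType) (V : lmodType K) (T : {linear V -> V}).
Implicit Types (p q : {poly K}) (u v w : V) (a b c : K) (X : set V).

Definition peval p v := \sum_(i < size p) p`_i *: iter i T v.

Lemma iter_linear n : linear (iter n T).
Proof. by elim: n => [|n IH] a u v //=; rewrite IH linearP. Qed.

Lemma peval_widen n p v : (size p <= n)%N ->
  peval p v = \sum_(i < n) p`_i *: iter i T v.
Proof.
move=> pn; rewrite /peval (big_ord_widen n (fun i => p`_i *: iter i T v)) //
  big_mkcond.
apply: eq_bigr => i _; case: ltnP => // ip.
by rewrite nth_default // scale0r.
Qed.

Lemma peval_linear p : linear (peval p).
Proof.
move=> a u v; rewrite /peval scaler_sumr -big_split /=; apply: eq_bigr => i _.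
by rewrite iter_linear scalerDr !scalerA mulrC.
Qed.

Lemma peval0 v :
  peval 0 v = 0. Proof. by rewrite /peval size_poly0 big_ord0. Qed.

Lemma pevalr0 p : peval p 0 = 0.
Proof. by have := peval_linear p (-1) 0 0; rewrite !scaleN1r !addNr. Qed.

Lemma pevalZl c p v : peval (c *: p) v = c *: peval p v.
Proof.
rewrite (peval_widen _ (size_scale_leq c p)) /peval scaler_sumr.
by apply: eq_bigr => i _; rewrite coefZ scalerA.
Qed.

Lemma pevalDl p q v : peval (p + q) v = peval p v + peval q v.
Proof.
pose n := maxn (size p) (size q).
rewrite (peval_widen _ (size_polyD p q)) (@peval_widen n p) ?leq_maxl //.
rewrite (@peval_widen n q) ?leq_maxr // -big_split; apply: eq_bigr => i _ /=.
by rewrite coefD scalerDl.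
Qed.

Lemma pevalC c v : peval c%:P v = c *: v.
Proof.
by rewrite (peval_widen _ (size_polyC_leq1 c)) big_ord1 /= coefC.
Qed.

Lemma peval_mulX p v : peval (p * 'X) v = peval p (T v).
Proof.
have [->|p0] := eqVneq p 0; first by rewrite mul0r !peval0.
rewrite /peval size_mulX // big_ord_recl /= coefMX eqxx scale0r add0r.
by apply: eq_bigr => i _; rewrite coefMX /= -iterS iterSr.
Qed.

Lemma pevalT p v : peval p (T v) = T (peval p v).
Proof.
rewrite /peval linear_sum; apply: eq_bigr => i _.
by rewrite linearZ -iterSr iterS.
Qed.

Lemma pevalM p q v : peval (p * q) v = peval p (peval q v).
Proof.
elim/poly_ind: p v => [|p c IH] v; first by rewrite mul0r !peval0.
rewrite mulrDl !pevalDl mul_polyC pevalZl pevalC; congr (_ + _).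
by rewrite -mulrA ['X * q]mulrC mulrA !peval_mulX IH pevalT.
Qed.

Lemma peval_XsubC p a v : peval (('X - a%:P) * p) v = peval p (T v - a *: v).
Proof.
rewrite mulrC mulrBr pevalDl peval_mulX -mulrN mulrC -polyCN mul_polyC pevalZl.
by have := peval_linear p (- a) v (T v); rewrite scaleNr addrC => <-;
  rewrite addrC.
Qed.

Lemma peval_XsubCl p a v :
  peval (('X - a%:P) * p) v = T (peval p v) - a *: peval p v.
Proof.
rewrite peval_XsubC; have := peval_linear p (- a) v (T v).
by rewrite !scaleNr ![- _ + _]addrC pevalT.
Qed.

Lemma peval_sum I (r : seq I) (F : I -> {poly K}) v :
  peval (\sum_(i <- r) F i) v = \sum_(i <- r) peval (F i) v.
Proof. by elim/big_rec2: _ => [|i x y _ <-]; rewrite ?peval0 ?pevalDl. Qed.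

Lemma peval_eigen p a v : T v = a *: v -> peval p v = p.[a] *: v.
Proof.
move=> Tv; rewrite /peval horner_coef scaler_suml; apply: eq_bigr => i _.
rewrite -scalerA; congr (_ *: _); elim: (i : nat) => [|n IH];
  first by rewrite scale1r.
by rewrite iterS IH linearZ /= Tv scalerA exprSr.
Qed.

(** This subspace contains the eigenvectors for all eigenvalues other than [a] and, by
    [peval_eigen], no nonzero one for [a]; it replaces the independence of eigenspaces. *)
Lemma coprime_eigen_subspace a :
  subspace [set v | exists2 p, p.[a] != 0 & peval p v = 0].
Proof.
split=> [|c u v [p pa pu] [q qa qv]].
  by exists 1; rewrite ?hornerC ?oner_neq0 ?pevalr0.
exists (p * q); first by rewrite hornerM mulf_neq0.
have pqu : peval (p * q) u = 0 by rewrite mulrC pevalM pu pevalr0.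
by rewrite peval_linear pqu pevalM qv pevalr0 scaler0 addr0.
Qed.

End OperatorPolynomials.

Section Eigenvectors.
Local Open Scope ring_scope.
Variables (K : closedFieldType) (V : lmodType K) (T : {linear V -> V}).
Implicit Types (p q : {poly K}) (u v w : V) (a b c : K) (X : set V).

(** Apply the linear factors of [p] one at a time: the first that kills the current nonzero vector
    exhibits it as an eigenvector. *)
Lemma annihilated_eigenvector X p v : subspace X -> (forall u, X u -> X (T u))
  -> p != 0 -> X v -> v != 0 -> peval T p v = 0 ->
  exists a, exists2 w, X w & w != 0 /\ T w = a *: w.
Proof.
move=> sX XT p0; have [r ->] := closed_field_poly_normal p.
elim: r v => [|a r IH] v Xv v0.
  rewrite big_nil pevalZl -[1]/(1%:P) pevalC scale1r => /eqP.
  by rewrite scaler_eq0 lead_coef_eq0 (negPf p0) (negPf v0).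
rewrite big_cons pevalZl peval_XsubC -pevalZl.
have [Tv|Tv] := eqVneq (T v - a *: v) 0.
  by move=> _; exists a, v => //; split=> //; apply: subr0_eq.
by apply: IH => //; apply: subspaceB => //; [apply: XT|apply: subspaceZ].
Qed.

Lemma findim_eigenvector X : subspace X -> (forall u, X u -> X (T u)) -> findim
  X ->
  (exists2 x, X x & x != 0) -> exists a, exists2 w, X w & w != 0 /\ T w = a *:
    w.
Proof.
move=> sX XT [s Xs] [v Xv v0].
have XTn n : X (iter n T v) by elim: n => //= n IH; apply: XT.
have [c [i ci0] cT] := @linear_dependence _ _ s (size s).+1
  (fun i => iter i T v) (ltnSn _) (fun i => Xs _ (XTn i)).
pose p := \poly_(j < (size s).+1) (if insub j is Some k then c k else 0).
have pE (j : 'I_(size s).+1) : p`_j = c j.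
  by rewrite coef_poly ltn_ord valK.
apply: (@annihilated_eigenvector X p v) => //.
  by apply: contra_neq ci0 => p0; rewrite -pE p0 coef0.
rewrite (peval_widen _ _ (size_poly _ _)) -[RHS]cT.
by apply: eq_bigr => j _; rewrite pE.
Qed.

End Eigenvectors.

(** * Finite-dimensional irreducible representations *)

Section FiniteDimensional.
Local Open Scope ring_scope.
Variables (K : closedFieldType) (G : groupType) (V : lmodType K).
Variable pi : representation G V.
Implicit Types (H M N S : set G) (g h x y z : G).
Implicit Types (X Y Q U W E : set V) (u v w : V) (a b c : K) (t : seq V).
Local Notation simple := (simple pi).
Local Notation stable := (stable pi).
Local Notation translate := (translate pi).
Local Notation orbit_span := (orbit_span pi).

Lemma simple_orbit_line H W v : subgroup H -> simple H W -> W v -> v != 0 ->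
  orbit_span H (line v) = W.
Proof.
move=> sH [sW HW _ Wmin] Wv v0.
have lW : orbit_span H (line v) `<=` W.
  apply: orbit_span_min => // h Hh u [c _ cu].
  by rewrite -(rep_actK pi h u) -cu; apply: HW => //; apply: subspaceZ.
apply/seteqP; split=> //; apply: Wmin => //.
- exact: orbit_span_subspace.
- exact: orbit_span_stable.
have lv : line v `<=` orbit_span H (line v) by exact: orbit_span_sub.
by exists v => //; apply: lv; apply: line_in.
Qed.

Lemma simple_monomial H W : nilpotent_group G -> subgroup H -> simple H W ->
  findim W -> exists H' v, [/\ subgroup H', H' `<=` H, W v /\ v != 0,
    (forall h, H' h -> exists c, pi h v = c *: v) & direct pi H H' (line v)].
Proof.
move=> [k]; rewrite lower_central_lcs => k1 sH siW [s];
  have [n] := ubnP (size s).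
elim: n s H W sH siW => // n IH s H W sH siW sn Ws.
have [sW HW [w0 Ww0 w00] Wmin] := siW.
pose Z := [set z | exists c, forall w, W w -> pi z w = c *: w].
have [HZ|HZ] := pselect (H `<=` Z).
  exists H, w0; split=> // [h /HZ[c cP]|u _]; first by exists c; apply: cP.
  by rewrite setDv => /orbit_span_set0.
pose P i := `[< lcs [set: G] i `&` H `<=` Z >].
have Pk : P k.
  by apply/asboolP => z [] /=; rewrite k1 => -> _; exists 1 => w _;
    rewrite rep_act1 scale1r.
have [i /asboolP iZ imin] := ex_minnP (ex_intro _ k Pk).
case: i iZ imin => [|i] iZ imin; first by case: HZ => z Hz; apply: iZ.
have [a [[ia Ha] Za]] : exists a : G, (lcs [set: G] i `&` H) a /\ ~ Z a.
  apply: contrapT => nZ; suff /imin : P i by rewrite ltnn.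
  by apply/asboolP => z iz; apply: contrapT => nz; apply: nZ; exists z.
have aH h : H h -> exists c, forall w, W w -> pi a (pi h w) = c *: pi h (pi a
  w).
  move=> Hh; have [|c cP] := iZ [~ a, h]%g.
    split; first exact: lcs_comm.
    by apply: subgroupM => //; [apply: subgroupV|apply: subgroupJ].
  by exists c => w Ww; rewrite -rep_actM commgC rep_actM cP // linearZ /=
    rep_actM.
have [|lam [w1 Ww1 [w10 aw1]]] := findim_eigenvector sW (fun u Wu => HW a u Ha
  Wu) (ex_intro _ s Ws).
  by exists w0.
have lam0 : lam != 0.
  by apply: contra_neq w10 => l0; apply/eqP;
    rewrite -(rep_act_eq0 pi a) aw1 l0 scale0r.
pose Wl := [set w | W w /\ pi a w = lam *: w].
have sWl : subspace Wl.
  split=> [|c u v [Wu au] [Wv av]]; first by split;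
    [case: sW|rewrite linear0 scaler0].
  split; first by case: sW => _; apply.
  by rewrite linearP au av scalerDr !scalerA mulrC.
have WlW : Wl `<=` W by move=> w [].
pose H1 := [set h | H h /\ forall w, W w -> pi a (pi h w) = pi h (pi a w)].
have sH1 : subgroup H1.
  split=> [|g h [Hg gP] [Hh hP]|h [Hh hP]].
  - by split=> [|w Ww]; [case: sH|rewrite !rep_act1].
  - split=> [|w Ww]; first exact: subgroupM.
    by rewrite !rep_actM gP ?hP //; apply: HW.
  - have HVh := subgroupV sH Hh; split=> // w Ww.
    by rewrite -{2}(rep_actK pi h w) hP ?rep_actVK //; apply: HW.
have H1H : H1 `<=` H by move=> h [].
(* An [h] outside [H1] moves [Wl] into the eigenspace for [c * lam] with [c != 1], and this differs
   from [lam] because [lam] is nonzero. *)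
have dH1 : direct pi H H1 Wl.
  move=> u [Wu au] Cu.
  have [p pl pu] : [set v | exists2 p, p.[lam] != 0 & peval (pi a) p v = 0] u.
    move: u Cu {Wu au}; apply: orbit_span_min;
      first exact: coprime_eigen_subspace.
    move=> h [Hh H1h] v [Wv av]; have [c cP] := aH h Hh.
    have c1 : c != 1.
      by apply/eqP => c1; apply: H1h; split=> // w /cP; rewrite c1 scale1r.
    exists ('X - (c * lam)%:P); last first.
      rewrite -[_ - _]mulr1 peval_XsubC -[1]/(1%:P) pevalC scale1r.
      by rewrite -{1}(rep_actK pi h v) cP // av linearZ rep_actK scalerA subrr.
    rewrite hornerXsubC subr_eq0; apply: contra_neq c1 => lamE.
    by apply: (mulIf lam0); rewrite -lamE mul1r.
  move: pu; rewrite (peval_eigen _ au) => /eqP.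
  by rewrite scaler_eq0 (negPf pl) => /eqP.
(* The [H]-span of [Y] is [W]. Splitting [H] into [H1] and the rest writes a vector of [Wl] as one
   of [Y] plus one from the other translates, and the latter vanishes by [dH1]. *)
have siWl : simple H1 Wl.
  split=> //; first by move=> h w [Hh hP] [Ww aw]; split;
    [apply: HW|rewrite hP // aw linearZ].
    by exists w1.
  move=> Y sY H1Y YWl [y Yy y0] w Wlw.
  have HE : H = H1 `|` (H `\` H1).
    by apply/seteqP; split=> h; [have [] := pselect (H1 h);
      [left|right]|case=> [[]|[]]].
  have Yw : orbit_span H Y w.
    apply: (Wmin (orbit_span H Y)) (WlW _ Wlw).
    - exact: orbit_span_subspace.
    - exact: orbit_span_stable.
    - apply: orbit_span_min => // h Hh v Yv; rewrite -(rep_actK pi h v).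
      by apply: HW => //; apply/WlW/YWl.
    - by exists y => //; move: y Yy {y0}; apply: orbit_span_sub.
  rewrite HE in Yw; have [u Yu [v Cv wE]] := orbit_span_setU Yw.
  have {}Yu : Y u.
    move: u Yu {wE}; apply: orbit_span_min => // h H1h v' Yv'.
    by rewrite -(rep_actK pi h v'); apply: H1Y.
  suff v0 : v = 0 by rewrite wE v0 addr0.
  apply: dH1; last by move: Cv; apply: orbit_span_mono.
  by apply: (subspaceDl sWl (YWl _ Yu)); rewrite -wE.
(* If [Wl] filled the span of [s], [a] would be scalar on [W]. *)
have [sWl'|[t ts Wlt]] := lspan_size_lt sWl (subset_trans WlW Ws).
  case: Za; exists lam => w /Ws /sWl' []; by [].
have [H' [v [sH' H'H1 [Wlv v0] H'v dv]]] := IH t H1 Wl sH1 siWl (leq_trans ts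
  sn) Wlt.
exists H', v; split=> //.
- by apply: subset_trans H1H.
- by split=> //; apply: WlW.
apply: (direct_trans sH1 H'H1 H1H dv).
by rewrite (simple_orbit_line sH1 siWl).
Qed.

End FiniteDimensional.

(** * From a direct sum of lines to an induced representation *)

Section Monomial.
Local Open Scope ring_scope.
Variables (K : fieldType) (G : groupType) (V : lmodType K).
Variable pi : representation G V.
Implicit Types (H M N S : set G) (g h x y z : G).
Implicit Types (X Y Q U W E : set V) (u v w : V) (a b c : K) (t : seq V).
Local Notation stable := (stable pi).
Local Notation translate := (translate pi).
Local Notation orbit_span := (orbit_span pi).

(** The form in which irreducibility is used: a linear [G]-stable condition met by one nonzero
    vector holds everywhere. *)
Lemma irreducible_full X u : irreducible pi -> subspace X -> stable [set: G] X
  -> X u -> u != 0 -> forall v, X v.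
Proof.
move=> [_ irr] sX GX Xu u0.
pose p : {pred V} := fun v => `[< X v >].
have pP v : (v \in p) <-> X v by split=> [/asboolP|Xv] //; apply/asboolP.
have pZ : GRing.scaler_closed p.
  by move=> a v /pP Xv; apply/pP; apply: subspaceZ.
have p0 : 0 \in p by apply/pP; case: sX.
have pD : {in p &, forall v w, v + w \in p}.
  by move=> v w /pP Xv /pP Xw; apply/pP; apply: subspaceD.
pose C := HB.pack_for (submodClosed V) p
  (GRing.isScaleClosed.Build K V p pZ) (GRing.isAddClosed.Build V p (conj p0
    pD)).
have [|C0|CT] := irr C; first by move=> g v /pP Xv; apply/pP; apply: GX.
  by case/eqP: u0; apply: C0; apply/pP.
by move=> v; apply/pP/CT.
Qed.

Section Functional.
Variables (H : set G) (v0 : V).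
Hypotheses (irr : irreducible pi) (sH : subgroup H) (v0_neq0 : v0 != 0).
Hypothesis Hv0 : forall h, H h -> exists c, pi h v0 = c *: v0.
Hypothesis dH : direct pi setT H (line v0).

Let C := orbit_span ([set: G] `\` H) (line v0).
Let sC : subspace C. Proof. exact: orbit_span_subspace. Qed.

Let functional_uniq u a b : C (u - a *: v0) -> C (u - b *: v0) -> a = b.
Proof.
move=> Ca Cb; have /dH E : line v0 ((a - b) *: v0) by exists (a - b).
have /eqP : (a - b) *: v0 = 0.
  apply: E; suff -> : (a - b) *: v0 = (u - b *: v0) - (u - a *: v0).
    by apply: (subspaceB sC).
  by rewrite opprB [RHS]addrC addrA subrK scalerBl.
by rewrite scaler_eq0 (negPf v0_neq0) orbF subr_eq0 => /eqP.
Qed.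

(** [lam] is the coordinate along [v0] modulo [C], and [u] is sent to the function
    [x |-> lam (pi x u)], which transforms by [chi] because [C] is [H]-stable. The kernel is a
    subrepresentation missing [v0]; surjectivity is obtained coset by coset. *)
Lemma monomial_of_direct : monomial pi.
Proof.
have GV u : exists a, C (u - a *: v0).
  pose X := [set u | exists a, C (u - a *: v0)].
  have sX : subspace X.
    split=> [|c w w' [a Ca] [b Cb]]; first by exists 0; rewrite scale0r subr0;
      case: sC.
    exists (c * a + b); rewrite scalerDl opprD addrACA -scalerA -scalerBr.
    by case: sC => _; apply.
  have XT : orbit_span [set: G] (line v0) `<=` X.
    apply: orbit_span_min => // g _ w gw.
    have [Hg|Hg] := pselect (H g); last first.
      by exists 0; rewrite scale0r subr0; apply: orbit_span_translate gw.
    have [d _ dw] := gw; have [c cv] := Hv0 Hg.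
    exists (d * c); rewrite -(rep_actK pi g w) -dw linearZ /= cv scalerA subrr.
    by case: sC.
  apply: XT; move: u; apply: (@irreducible_full _ v0) => //.
  - exact: orbit_span_subspace.
  - exact: orbit_span_stable.
  have sub : line v0 `<=` orbit_span setT (line v0) by exact: orbit_span_sub.
  by apply: sub; apply: line_in.
have /choice[lam lamP] := GV.
have lamE u a : C (u - a *: v0) -> lam u = a by apply: functional_uniq.
have lam_lin c u w : lam (c *: u + w) = c * lam u + lam w.
  apply: lamE; rewrite scalerDl opprD addrACA -scalerA -scalerBr.
  by case: sC => _; apply.
have [L LP] := subgroup_groupClosed sH.
have /choice[chi chiP] h : exists c, H h -> pi h v0 = c *: v0.
  by have [/Hv0[c]|Hh] := pselect (H h); [exists c|exists 0].
have LH (h : subgroup_of L) : H (val h) by apply/LP; apply: subgroup_valP.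
have chi0 (h : subgroup_of L) : chi (val h) != 0.
  apply: contra_neq v0_neq0 => c0; apply/eqP; rewrite -(rep_act_eq0 pi (val h)).
  by rewrite chiP // c0 scale0r.
have chiM (h k : subgroup_of L) : chi (val (h * k)%g) = chi (val h) * chi (val
  k).
  have : pi (val h * val k)%g v0 = (chi (val h) * chi (val k)) *: v0.
    by rewrite rep_actM (chiP _ (LH k)) linearZ /= (chiP _ (LH h)) scalerA
      mulrC.
  rewrite (chiP _ (LH (h * k)%g)) => /eqP;
    rewrite -subr_eq0 -scalerBl scaler_eq0.
  by rewrite (negPf v0_neq0) orbF subr_eq0 => /eqP ->.
pose X : character K (subgroup_of L) := Character chi0 chiM.
have lamH h u : H h -> lam (pi h u) = chi h * lam u.
  move=> Hh; apply: lamE.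
  have -> : pi h u - (chi h * lam u) *: v0 = pi h (u - lam u *: v0).
    by rewrite linearB [pi h (_ *: _)]linearZ /= (chiP _ Hh) scalerA mulrC.
  apply: orbit_span_act (lamP u) => g [_ Hg]; split=> // Hhg.
  by apply: Hg; apply/(subgroupMl _ sH Hh).
have lam_v0 : lam v0 = 1 by apply: lamE; rewrite scale1r subrr; case: sC.
have lam_out g : ~ H g -> lam (pi g v0) = 0.
  move=> Hg; apply: lamE; rewrite scale0r subr0.
  have MHg : ([set: G] `\` H) g by [].
  by apply: (orbit_span_translate MHg); apply/translate_act; apply: line_in.
have lam0 : lam 0 = 0 by apply: lamE; rewrite scale0r subr0; case: sC.
have lamZ c u : lam (c *: u) = c * lam u.
  by have := lam_lin c u 0; rewrite lam0 !addr0.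
pose rho := char_rep X.
have supp u : exists s : seq G, forall x, lam (pi x u) != 0 ->
    exists2 g, g \in s & right_coset L g x.
  have : orbit_span [set: G] (line v0) u.
    apply: (@irreducible_full _ v0) => //;
      [exact: orbit_span_subspace|exact: orbit_span_stable|].
    have sub : line v0 `<=` orbit_span setT (line v0) by exact: orbit_span_sub.
    by apply: sub; apply: line_in.
  move: u; apply: orbit_span_min.
    split=> [|c u w [s sP] [t tP]]; first by exists [::] => x;
      rewrite linear0 lam0 eqxx.
    exists (s ++ t) => x; rewrite linearP lam_lin.
    have [us|us] := eqVneq (lam (pi x u)) 0.
      rewrite us mulr0 add0r => /tP[g gt gx].
      by exists g; rewrite // mem_cat gt orbT.
    by move=> _; have [g gs gx] := sP x us; exists g; rewrite // mem_cat gs.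
  (* The function attached to [pi g v0] is supported on the right coset of [g^-1]. *)
  move=> g _ u [c _ cu]; exists [:: (g^-1)%g] => x.
  rewrite -(rep_actK pi g u) -cu linearZ /= linearZ /= lamZ -rep_actM => lx.
  exists g^-1%g; first exact: mem_head.
  have /LP Lxg : H (x * g)%g.
    by apply: contrapT => /lam_out l0; rewrite l0 mulr0 eqxx in lx.
  by exists (SubgroupOf Lxg) => //=; rewrite mulgK.
have indP u : ind_pred rho (fun x => lam (pi x u)).
  apply: ind_predP => // h g.
  by rewrite rep_actM lamH.
pose Psi u : ind_space rho := IndSpace (indP u).
have PsiL : linear Psi.
  move=> c u w; apply: val_inj; apply/funext => x /=.
  by rewrite linearP lam_lin.
pose F : {linear V -> ind_space rho} :=
  HB.pack_for {linear V -> ind_space rho} Psi (GRing.isLinear.Build K V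
    (ind_space rho) *:%R Psi PsiL).
exists L, X, F; last first.
  move=> g u; apply: val_inj; apply/funext => x /=.
  by rewrite rep_actM.
have Finj : injective Psi.
  have ker u : Psi u = 0 -> u = 0.
    move=> Fu; apply: contrapT => /eqP u0.
    have kerT : forall w, [set w | forall x, lam (pi x w) = 0] w.
      apply: (@irreducible_full _ u) => //.
      - split=> [x|c w w' wP w'P x]; first by rewrite linear0.
        by rewrite linearP lam_lin wP w'P mulr0 addr0.
      - by move=> g w _ wP x; rewrite -rep_actM.
      - by move=> x; have /(congr1 (fun f : ind_space rho => f x)) := Fu.
    have /eqP := kerT v0 1%g; rewrite rep_act1 lam_v0.
    by rewrite oner_eq0.
  move=> u w uw; apply/subr0_eq/ker.
  by have := PsiL (-1) w u; rewrite !scaleN1r uw addNr [- w + u]addrC => ->.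
have Fsurj : forall f : ind_space rho, exists u, Psi u = f.
  (* Induction on a list of cosets covering the support: the image of [f g *: pi g^-1 v0] agrees
     with [f] on the coset of [g] and vanishes elsewhere, so subtracting it removes that coset. *)
  suff cover (s : seq G) : forall f : ind_space rho,
      (forall x, f x != 0 -> exists2 g, g \in s & right_coset L g x) -> exists
        u, Psi u = f.
    move=> f; have /asboolP[_ [s sE]] := ind_valP f.
    apply: (cover s) => x fx.
    have : [set x | f x != 0] x by [].
    by rewrite sE => -[g gs gx]; exists g.
  elim: s => [|g s IH] f fs.
    exists 0; apply: val_inj; apply/funext => x /=; rewrite linear0 lam0.
    by apply/eqP; rewrite eq_sym; apply: contraT => /fs[].
  have fE (h : subgroup_of L) x : f (val h * x)%g = chi (val h) * f x.
    by have /asboolP[-> _] := ind_valP f.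
  have PE x : Psi (f g *: pi g^-1%g v0) x = f g * lam (pi (x * g^-1)%g v0).
    by rewrite /= linearZ /= lamZ rep_actM.
  have [x|w wE] := IH (f - Psi (f g *: pi g^-1%g v0)).
    have -> : (f - Psi (f g *: pi g^-1%g v0)) x = f x - f g * lam (pi (x *
      g^-1)%g v0).
      by rewrite -PE.
    have [Hxg|Hxg] := pselect (H (x * g^-1)%g).
      have xE : x = (x * g^-1 * g)%g by rewrite mulgVK.
      rewrite lamH // lam_v0 mulr1 {1}xE.
      have /LP Lxg := Hxg; have /= -> := fE (SubgroupOf Lxg) g.
      by rewrite mulrC subrr eqxx.
    rewrite lam_out // mulr0 subr0 => /fs[g'];
      rewrite inE => /predU1P[->|g's] g'x.
      by case: Hxg; case: g'x => h _ <-; rewrite mulgK.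
    by exists g'.
  exists (w + f g *: pi g^-1%g v0).
  have := PsiL 1 w (f g *: pi g^-1%g v0); rewrite !scale1r => ->.
  by rewrite wE subrK.
have /choice[Fi FiP] := Fsurj.
by exists Fi => u; [apply: Finj|]; apply: FiP.
Qed.

End Functional.
End Monomial.

(** * Schur's lemma in countable dimension *)

Section Dixmier.
Local Open Scope ring_scope.
Variables (K : closedFieldType) (G : groupType) (V : lmodType K).
Variable pi : representation G V.
Implicit Types (g h x y z : G) (X Y : set V) (u v w : V) (a b c : K).

Lemma finitely_generated_countable : finitely_generated G ->
  exists e : nat -> G, forall x, exists n, e n = x.
Proof.
move=> [s sG].
pose word (l : seq (bool * nat)) : G :=
  foldr (fun p x => if p.1 then nth 1 s p.2 * x else (nth 1 s p.2)^-1 * x)%g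
    1%g l.
have wordP x : exists l, word l = x.
  (* Asking that left multiplication by both [x] and [x^-1] preserve the values of words makes
     closure under products and inverses immediate. *)
  pose A := [set x | forall l, exists2 l1, word l1 = (x * word l)%g &
                               exists l2, word l2 = (x^-1 * word l)%g].
  have sA : subgroup A.
    split=> [l|y z yA zA l|y yA l].
    - by exists l; rewrite ?mul1g //; exists l; rewrite invg1 mul1g.
    - have [l1 l1E _] := zA l; have [l2 l2E _] := yA l1.
      have [_ _ [l3 l3E]] := yA l; have [_ _ [l4 l4E]] := zA l3.
      exists l2; first by rewrite l2E l1E mulgA.
      by exists l4; rewrite l4E l3E invgM mulgA.
    - have [l1 l1E [l2 l2E]] := yA l; exists l2 => //.
      by exists l1; rewrite invgK.
  have : generated [set` s] `<=` A.
    apply: generated_min => // y ys l.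
    exists ((true, index y s) :: l); first by rewrite /= nth_index.
    by exists ((false, index y s) :: l); rewrite /= nth_index.
  rewrite sG => /(_ x I [::])[l lE _]; exists l.
  by rewrite lE /= mulg1.
exists (fun n => odflt 1%g (omap word (unpickle n : option (seq (bool *
  nat))))) => x.
by have [l lE] := wordP x; exists (pickle l); rewrite pickleK.
Qed.

(* Otherwise T - a is invertible for every a, and the uncountably many vectors
   (T - a)^-1 v are linearly independent in a space of countable dimension. *)
Lemma schur (T : {linear V -> V}) : finitely_generated G ->
  ~ countable [set: K] -> irreducible pi ->
  (forall g v, T (pi g v) = pi g (T v)) ->
  exists a, forall v, T v = a *: v.
Proof.
move=> fgG uncK irr TG; have [[v0 v00] _] := irr.
have [[a [v v_neq0 Tv]]|noeig] := pselect (exists a, exists2 v, v != 0 & T v =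
  a *: v).
  exists a; apply: (@irreducible_full _ _ _ pi [set v | T v = a *: v] v) => //.
    split=> [|c u w /= Tu Tw]; first by rewrite /= linear0 scaler0.
    by rewrite linearP Tu Tw scalerDr !scalerA mulrC.
  by move=> g u _ /= Tu; rewrite TG Tu linearZ.
exfalso.
have inj a u : T u = a *: u -> u = 0.
  by move=> Tu; apply: contrapT => /eqP u0; apply: noeig; exists a, u.
have lin a : linear (fun u => T u - a *: u).
  move=> c u w; rewrite linearP scalerDr opprD addrACA scalerBr.
  by rewrite !scalerA mulrC.
have surj a v : exists u, T u - a *: u = v.
  apply: (@irreducible_full _ _ _ pi [set v | exists u, T u - a *: u = v]
    (T v0 - a *: v0)) => //.
  - split=> [|c _ _ [u <-] [w <-]]; first by exists 0;
    rewrite linear0 scaler0 subr0.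
    by exists (c *: u + w); rewrite lin.
  - by move=> g _ _ [u <-]; exists (pi g u);
    rewrite TG [RHS]linearB [pi g (a *: _)]linearZ.
  - by exists v0.
  - by apply: contra_neq v00 => /subr0_eq /inj.
have /choice[S SP] a : exists u, T u - a *: u = v0 by apply: surj.
have [e eP] := finitely_generated_countable fgG.
pose t n : seq V := [seq pi (e i) v0 | i <- iota 0 n].
have tmono n m : (n <= m)%N -> lspan [set` t n] `<=` lspan [set` t m].
  move=> nm; apply: lspan_mono => _ /= /mapP[i + ->];
    rewrite mem_iota => /andP[_ im].
  by apply: map_f; rewrite mem_iota /= (leq_trans im).
have Vt : forall v, exists n, lspan [set` t n] v.
  apply: (@irreducible_full _ _ _ pi [set v | exists n, lspan [set` t n] v] v0)
    => //.
  - split=> [|c u w [n nu] [m mw]]; first by exists 0%N;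
    case: (lspan_subspace [set` t 0]).
    exists (maxn n m); case: (lspan_subspace [set` t (maxn n m)]) => _; apply.
      by apply: tmono nu; apply: leq_maxl.
    by apply: tmono mw; apply: leq_maxr.
  - move=> g v _ [n]; move: v.
    suff : lspan [set` t n] `<=` translate pi g^-1%g [set v | exists m, lspan
      [set` t m] v].
      by move=> H v /H; rewrite /translate /= invgK.
    apply: lspan_min.
      apply: translate_subspace; split=> [|c u w [p pu] [m mw]].
        by exists 0%N; case: (lspan_subspace [set` t 0]).
      exists (maxn p m); case: (lspan_subspace [set` t (maxn p m)]) => _; apply.
        by apply: tmono pu; apply: leq_maxl.
      by apply: tmono mw; apply: leq_maxr.
    move=> _ /= /mapP[i _ ->]; rewrite /translate /= invgK -rep_actM.
    have [m <-] := eP (g * e i)%g; exists m.+1; apply: sub_lspan.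
    by apply/mapP; exists m; rewrite // mem_iota /=.
  - have [m em] := eP 1%g; exists m.+1; apply: sub_lspan; apply/mapP.
    by exists m; rewrite ?em ?rep_act1 // mem_iota /=.
have /choice[N NP] a : exists n, lspan [set` t n] (S a) by apply: Vt.
(* A countable union of finite sets cannot exhaust the field, so infinitely many [S a] lie in one
   finite-dimensional span. *)
have [n infN] : exists n, infinite_set [set a | N a = n].
  apply: contrapT => finN; apply: uncK.
  have -> : [set: K] = \bigcup_n [set a | N a = n].
    by apply/seteqP; split=> a // _; exists (N a).
  apply: bigcup_countable => // n _; apply: finite_set_countable.
  by apply: contrapT => infn; apply: finN; exists n.
have [f fN f_inj] : exists2 f : nat -> K, forall i, N (f i) = n & injective f.
  move: infN => /infiniteP/card_leP[f]; exists (fun i => val (f (to_setT i))).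
    by move=> i; have := set_valP (f (to_setT i)).
  move=> i j /val_inj fij.
  have : to_setT i = to_setT j by apply: 'inj_f fij; rewrite in_setT.
  by move/(congr1 val).
pose mu (i : 'I_n.+1) : K := f i.
have mu_inj : injective mu by move=> i j /f_inj /val_inj.
have [|i|c [k ck0] cS] := @linear_dependence _ _ (t n) n.+1 (fun i => S (mu i)).
- by rewrite size_map size_iota.
- by have := NP (mu i); rewrite fN.
(* Clearing denominators: [v0] is the full product of the [T - mu j] applied to some [w], so
   [S (mu i)] is [q i] at [T] applied to [w], and the dependence reads [peval T p w = 0]. At [mu k]
   only the term of index [k] survives, hence [p] is nonzero. *)
pose q i := \prod_(j < n.+1 | j != i) ('X - (mu j)%:P).
pose p := \sum_(i < n.+1) c i *: q i.
have [w wv0] : exists w, peval T (\prod_(j < n.+1) ('X - (mu j)%:P)) w = v0.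
  elim/big_rec: _ => [|j r _ [w wr]]; first by exists v0;
    rewrite -[1]/(1%:P) pevalC scale1r.
  have [u uw] := surj (mu j) w; exists u.
  by rewrite peval_XsubC uw.
have Sw i : S (mu i) = peval T (q i) w.
  apply/subr0_eq/(inj (mu i)).
  suff : T (S (mu i) - peval T (q i) w) - mu i *: (S (mu i) - peval T (q i) w)
    = 0.
    by move/subr0_eq.
  have /(_ (-1) (peval T (q i) w) (S (mu i))) := lin (mu i).
  rewrite /= !scaleN1r [- _ + S _]addrC => ->; rewrite SP -peval_XsubCl.
  suff <- : \prod_(j < n.+1) ('X - (mu j)%:P) = ('X - (mu i)%:P) * q i.
    by rewrite wv0 addNr.
  by rewrite (bigD1 i).
have pw : peval T p w = 0.
  rewrite /p peval_sum -[RHS]cS; apply: eq_bigr => i _.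
  by rewrite pevalZl Sw.
have p0 : p != 0.
  apply: contra_neq ck0 => p0; have := congr1 (fun r : {poly K} => r.[mu k]) p0.
  rewrite horner0 /p horner_sum (bigD1 k) //= big1 => [|i ik]; last first.
    rewrite hornerZ horner_prod (bigD1 k) //= 1?eq_sym // hornerXsubC subrr
      mul0r.
    by rewrite mulr0.
  rewrite addr0 hornerZ horner_prod => /eqP; rewrite mulf_eq0 => /orP[/eqP //|].
  rewrite prodf_seq_eq0 => /hasP[j _ /andP[jk]].
  by rewrite hornerXsubC subr_eq0 => /eqP /mu_inj jE; rewrite jE eqxx in jk.
have w0 : w != 0.
  by apply: contra_neq v00 => w0; rewrite -wv0 w0 pevalr0.
have [||||||a [u _ [u0 Tu]]] := @annihilated_eigenvector _ _ T setT p w => //.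
by apply: noeig; exists a, u.
Qed.

End Dixmier.

(** * Weight spaces *)

Section Weights.
Local Open Scope ring_scope.
Variables (K : fieldType) (G : groupType) (V : lmodType K).
Variable pi : representation G V.
Implicit Types (g h x y z : G) (X Y : set V) (u v w : V) (a b c : K).

Section Pair.
Variables (H : groupClosed G) (chi : character K (subgroup_of H)).

(** A concrete form of Hom_H(chi, pi), through evaluation at 1. *)
Definition weight_space : set V := [set v | forall h : subgroup_of H, pi (val
  h) v = chi h *: v].

Lemma weight_space_subspace : subspace weight_space.
Proof.
split=> [h|a u v wu wv h]; first by rewrite linear0 scaler0.
by rewrite linearP wu wv scalerDr !scalerA mulrC.
Qed.

Lemma weight_space_hom v : weight_space v ->
  hom_pred (char_rep chi) (res_rep pi H) (fun z : K^o => (z : K) *: v).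
Proof.
move=> wv; apply/asboolP; split=> [a u w|h u];
  first by rewrite scalerDl scalerA.
by rewrite /= linearZ /= wv scalerA /char_act mulrC.
Qed.

Lemma hom_weight_space (f : hom_space (char_rep chi) (res_rep pi H)) :
  weight_space (f (1 : K^o)).
Proof.
have /asboolP[fl fe] := hom_valP f; move=> h.
rewrite -[LHS](fe h) /= /char_act; have := fl (chi h) 1 0.
have f0 : f 0 = 0.
  by have := fl 1 0 0; rewrite !scale1r addr0 => /(congr1 (fun v => v - f 0));
    rewrite addrK subrr.
by rewrite addr0 f0 addr0.
Qed.

Lemma hom_space_ext (f f' : hom_space (char_rep chi) (res_rep pi H)) :
  f (1 : K^o) = f' (1 : K^o) -> f = f'.
Proof.
have hom1 (k : hom_space (char_rep chi) (res_rep pi H)) (z : K^o) : k z = (z :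
  K) *: k (1 : K^o).
  have /asboolP[fl fe] := hom_valP k.
  have f0 : k 0 = 0.
    by have := fl 1 0 0; rewrite !scale1r addr0 => /(congr1 (fun v => v - k
      0)); rewrite addrK subrr.
  by have := fl z 1 0; rewrite addr0 f0 addr0 => <-; congr (k _);
    rewrite -[LHS]mulr1.
by move=> E; apply: val_inj; apply/funext => z; rewrite /= hom1 E -hom1.
Qed.

Lemma weight_space_findim :
  finite_dimensional (hom_space (char_rep chi) (res_rep pi H)) -> findim
    weight_space.
Proof.
move=> [n [[v2r lin [r2v v2rK r2vK]]]].
have linV : linear r2v.
  by move=> a r r'; apply: (can_inj v2rK); rewrite lin !r2vK.
pose ev (f : hom_space (char_rep chi) (res_rep pi H)) : V := f (1 : K^o).
pose s := [seq ev (r2v (delta_mx 0 i)) | i <- enum 'I_n].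
have ss := lspan_subspace [set` s].
exists s => v wv; pose f : hom_space (char_rep chi) (res_rep pi H) := HomSpace
  (weight_space_hom wv).
have -> : v = ev f by rewrite /ev /= scale1r.
rewrite -(v2rK f).
pose X := [set r : 'rV[K]_n | lspan [set` s] (ev (r2v r))].
have evl a k k' : ev (a *: k + k') = a *: ev k + ev k' by [].
have sX : subspace X.
  split; last by move=> a r r' Xr Xr'; rewrite /X /= linV evl; case: ss => _;
    apply.
  rewrite /X /=; have -> : r2v 0 = 0.
    by have := linV (-1) 0 0; rewrite !scaleN1r !addNr.
  by have := evl (-1) 0 0; rewrite !scaleN1r !addNr => ->; case: ss.
suff : X (v2r f) by [].
rewrite [v2r f]row_sum_delta; apply: (subspace_sum _ sX) => i.
apply: (subspaceZ _ sX); rewrite /X /=; apply: sub_lspan.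
by apply: map_f; rewrite mem_enum.
Qed.

End Pair.

(** [W] is the line of a weight vector; [H]-maps send it into the weight space, which bounds its
    isotypic part. *)
Lemma finite_weight_good : finite_weight pi -> exists H W, good pi H W.
Proof.
move=> [H [chi [[f f0] fin]]]; pose v0 := f (1 : K^o).
have wv0 : weight_space chi v0 by exact: hom_weight_space.
have v00 : v0 != 0.
  by apply: contra_neq f0 => E; apply: hom_space_ext; rewrite -/v0 E.
have sH : subgroup [set` H] by exact: groupClosed_subgroup.
have Hl v : line v0 v -> weight_space chi v.
  by move=> [c _ <-] h; rewrite linearZ /= wv0 !scalerA mulrC.
exists [set` H], (line v0); split=> //.
  split; [exact: subspace_line| |by exists v0 => //; apply: line_in|].
    move=> h v Hh lv; have /= -> := Hl _ lv (SubgroupOf Hh).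
    by apply: subspaceZ => //; apply: subspace_line.
  move=> Y sY _ Yl [y Yy y0] v [c _ <-].
  have [d _ dv] := Yl _ Yy.
  have d0 : d != 0 by apply: contra_neq y0 => d0; rewrite -dv d0 scale0r.
  have -> : c *: v0 = (c / d) *: y by rewrite -dv scalerA divfK.
  exact: subspaceZ.
apply: findim_sub (weight_space_findim fin).
have sE := weight_space_subspace chi.
apply: lspan_min => // _ [k hk [v lv ->]] h.
have [_ <- //] := hk; last exact: subgroup_valP.
by rewrite (Hl _ lv) (homZ _ (subspace_line v0) hk).
Qed.

Lemma finite_weight_of_line (H : groupClosed G) (chi : character K (subgroup_of
  H)) v0 :
  v0 != 0 -> weight_space chi v0 -> weight_space chi `<=` line v0 ->
    finite_weight pi.
Proof.
move=> v00 wv0 wl; exists H, chi.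
pose ev (f : hom_space (char_rep chi) (res_rep pi H)) : V := f (1 : K^o).
pose mk c : hom_space (char_rep chi) (res_rep pi H) :=
  HomSpace (weight_space_hom (subspaceZ c (weight_space_subspace chi) wv0)).
have evmk c : ev (mk c) = c *: v0 by rewrite /ev /= scale1r.
have evl a k k' : ev (a *: k + k') = a *: ev k + ev k' by [].
split.
  exists (mk 1); apply: contra_neq v00 => m0.
  have := evmk 1; rewrite scale1r => <-; rewrite m0.
  by have := evl (-1) 0 0; rewrite !scaleN1r !addNr.
have /choice[co coP] f : exists c, ev f = c *: v0.
  by have [c _ E] := wl _ (hom_weight_space f); exists c; rewrite E.
exists 1%N; constructor; exists (fun f => (co f)%:M).
  move=> a f f'; apply/rowP => i; rewrite (ord1 i) !mxE !eqxx !mulr1n.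
  apply/eqP; rewrite -subr_eq0 -[_ == 0]orbF -(negPf v00) -scaler_eq0.
  by rewrite scalerBl scalerDl -scalerA -!coP evl subrr.
exists (fun r : 'rV[K]_1 => mk (r 0 0)) => [f|r].
  apply: hom_space_ext; rewrite -/(ev _) evmk mxE eqxx mulr1n.
  by rewrite -coP.
apply/rowP => i; rewrite (ord1 i) !mxE eqxx mulr1n.
apply/eqP; rewrite -subr_eq0 -[_ == 0]orbF -(negPf v00) -scaler_eq0.
by rewrite scalerBl -coP evmk subrr.
Qed.

(* Frobenius reciprocity: v0 |-> v1 extends to a G-map. Here v0 is the image of
   the function supported on H, and lam the evaluation at 1. *)
Lemma eigenvector_relation (H : groupClosed G)
    (chi : character K (subgroup_of H)) v0 v1 (lam : V -> K) (l : seq (K * G)) :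
  (forall a u v, lam (a *: u + v) = a * lam u + lam v) -> lam v0 = 1 ->
  (forall g, g \notin H -> lam (pi g v0) = 0) ->
  weight_space chi v0 -> weight_space chi v1 ->
  \sum_(p <- l) p.1 *: pi p.2 v0 = 0 -> \sum_(p <- l) p.1 *: pi p.2 v1 = 0.
Proof.
move=> laml lam1 lam_out wv0 wv1.
have lam0 : lam 0 = 0.
  by have := laml (-1) 0 0; rewrite scaleN1r addNr => ->; rewrite mulN1r addNr.
have lamZ a u : lam (a *: u) = a * lam u by rewrite -[a *: u]addr0 laml lam0
  addr0.
have lamD u v : lam (u + v) = lam u + lam v by rewrite -[u]scale1r laml mul1r
  scale1r.
have [n] := ubnP (size l); elim: n l => // n IH [|[c g] l];
  first by rewrite !big_nil.
(* [P] selects the terms in the coset [g H]. On a weight vector they add up to a multiple of its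
   image under [g], with the same scalar for [v0] and [v1]; applying [lam] after [g^-1] shows that
   this scalar is 0. The head satisfies [P], so the remaining relation is shorter. *)
move=> ln; set m := _ :: l; pose P (p : K * G) := (g^-1 * p.2)%g \in H.
have Pcg : P (c, g) by rewrite /P /= mulVg; apply: gpred1.
pose chiG x : K := if insub x is Some h then chi h else 0.
have inP v : weight_space chi v ->
    \sum_(p <- m | P p) p.1 *: pi p.2 v =
    (\sum_(p <- m | P p) p.1 * chiG (g^-1 * p.2)%g) *: pi g v.
  move=> wv; rewrite scaler_suml; apply: eq_bigr => p Pp.
  rewrite /chiG insubT -{1}(mulVKg g p.2) rep_actM (wv (SubgroupOf Pp)) linearZ.
  by rewrite scalerA.
rewrite (bigID P) /= inP // => E.
have d0 : \sum_(p <- m | P p) p.1 * chiG (g^-1 * p.2)%g = 0.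
  have := congr1 (fun v => lam (pi g^-1%g v)) E.
  rewrite linear0 lam0 linearD lamD linearZ /= rep_actVK lamZ lam1 mulr1.
  rewrite linear_sum /= [X in _ + X](_ : _ = 0) ?addr0 //.
  elim/big_rec: _ => [|p u nPp lu]; first exact: lam0.
  by rewrite lamD lu linearZ /= lamZ -rep_actM lam_out // mulr0 addr0.
rewrite d0 scale0r add0r in E; rewrite (bigID P) /= inP // d0 scale0r add0r.
rewrite -big_filter; rewrite -big_filter in E; apply: IH E.
rewrite /m /= Pcg /= size_filter; apply: leq_ltn_trans (count_size _ _) _.
by rewrite -ltnS.
Qed.

End Weights.

(** * The two implications *)

Section MonomialWeight.
Local Open Scope ring_scope.
Variables (K : closedFieldType) (G : groupType) (V : lmodType K).
Variable pi : representation G V.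

(** Each weight vector [v1] is the image of [v0] under an operator commuting with [G]; by [schur] it
    is a multiple of [v0], so the weight space is a line. *)
Lemma monomial_finite_weight : finitely_generated G -> ~ countable [set: K] ->
  irreducible pi -> monomial pi -> finite_weight pi.
Proof.
move=> fgG uncK irr [H [chi [F [Fi FK FiK] FG]]].
(* [chi] extended by 0 is the element of the induced space supported on the trivial coset. *)
pose chiG (x : G) : K^o := if insub x is Some h then chi h else 0.
have chiGin (h : subgroup_of H) : chiG (val h) = chi h by rewrite /chiG valK.
have chiGout x : x \notin H -> chiG x = 0 by move=> Hx; rewrite /chiG insubN.
have HE x : x \in H -> exists h : subgroup_of H, x = val h.
  by move=> Hx; exists (SubgroupOf Hx).
have chiGl (h : subgroup_of H) x : chiG (val h * x)%g = chi h * chiG x.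
  have Hh := subgroup_valP h.
  have [Hx|Hx] := boolP (x \in H).
    have [k ->] := HE x Hx.
    by rewrite [chiG (val k)]chiGin -charM -chiGin.
  rewrite !chiGout ?mulr0 //; apply: contra Hx => Hhx.
  by rewrite -(mulKg (val h) x); apply: gpredM => //; apply: gpredVr.
have chiGr (h : subgroup_of H) x : chiG (x * val h)%g = chi h * chiG x.
  have Hh := subgroup_valP h.
  have [Hx|Hx] := boolP (x \in H).
    have [k ->] := HE x Hx.
    by rewrite [chiG (val k)]chiGin mulrC -charM -chiGin.
  rewrite !chiGout ?mulr0 //; apply: contra Hx => Hhx.
  by rewrite -(mulgK (val h) x); apply: gpredM => //; apply: gpredVr.
have deltaP : ind_pred (char_rep chi) chiG.
  apply: ind_predP => [h x|]; first exact: chiGl.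
  exists [:: 1%g] => x cx; exists 1%g; first exact: mem_head.
  have Hx : x \in H by apply: contraNT cx => /chiGout ->.
  by exists (SubgroupOf Hx) => //=; rewrite mulg1.
pose delta := IndSpace deltaP; pose v0 := Fi delta.
have Fv0 : F v0 = delta by exact: FiK.
pose lam v : K := F v 1%g.
have laml a u v : lam (a *: u + v) = a * lam u + lam v.
  by rewrite /lam linearP.
have lam1 : lam v0 = 1.
  rewrite /lam Fv0 /=; have := chiGin 1%g; rewrite /= => ->; exact: char1.
have lam_out g : g \notin H -> lam (pi g v0) = 0.
  by move=> Hg; rewrite /lam FG Fv0 /= mul1g; apply: chiGout.
have v00 : v0 != 0.
  apply/eqP => v00; move: lam1; rewrite /lam v00 linear0 /= => /eqP.
  by rewrite eq_sym oner_eq0.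
have wv0 : weight_space pi chi v0.
  move=> h; apply: (can_inj FK); rewrite FG linearZ /= Fv0.
  by apply: val_inj; apply/funext => x /=; rewrite chiGr.
apply: (finite_weight_of_line v00 wv0) => v1 wv1.
(* Vectors are written as formal combinations of translates of [v0]; [rel] will show that [T] does
   not depend on the combination chosen. *)
pose ev (l : seq (K * G)) v := \sum_(p <- l) p.1 *: pi p.2 v.
pose scale a (l : seq (K * G)) := [seq (a * p.1, p.2) | p <- l].
have ev_scale a l v : ev (scale a l) v = a *: ev l v.
  by rewrite /ev big_map scaler_sumr; apply: eq_bigr => p _; rewrite scalerA.
have ev_cat l m v : ev (l ++ m) v = ev l v + ev m v by rewrite /ev big_cat.
have ev_act g l v : ev [seq (p.1, (g * p.2)%g) | p <- l] v = pi g (ev l v).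
  rewrite /ev big_map linear_sum; apply: eq_bigr => p _.
  by rewrite rep_actM linearZ.
have rel l m : ev l v0 = ev m v0 -> ev l v1 = ev m v1.
  move=> lm; apply/subr0_eq.
  have := @eigenvector_relation _ _ _ pi H chi v0 v1 lam (l ++ scale (-1) m)
            laml lam1 lam_out wv0 wv1.
  rewrite -!/(ev _ _) !ev_cat !ev_scale !scaleN1r => -> //.
  by rewrite lm subrr.
have /choice[L LP] u : exists l, ev l v0 = u.
  apply: (@irreducible_full _ _ _ pi [set u | exists l, ev l v0 = u] v0) => //.
  - split=> [|a _ _ [l <-] [m <-]]; first by exists [::]; rewrite /ev big_nil.
    by exists (scale a l ++ m); rewrite ev_cat ev_scale.
  - move=> g _ _ [l <-]; eexists; exact: ev_act.
  - by exists [:: (1, 1%g)]; rewrite /ev big_seq1 rep_act1 scale1r.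
pose T u := ev (L u) v1.
have Tl : linear T.
  move=> a u v; rewrite /T -ev_scale -ev_cat; apply: rel.
  by rewrite ev_cat ev_scale !LP.
pose TL : {linear V -> V} :=
  HB.pack_for {linear V -> V} T (GRing.isLinear.Build K V V *:%R T Tl).
have [|a Ta] := schur (T := TL) fgG uncK irr.
  by move=> g v; rewrite /= /T -ev_act; apply: rel; rewrite ev_act !LP.
exists a => //; rewrite -Ta /= /T.
rewrite (@rel _ [:: (1, 1%g)]); first by rewrite /ev big_seq1 rep_act1 scale1r.
by rewrite LP /ev big_seq1 rep_act1 scale1r.
Qed.

Lemma finite_weight_monomial : finitely_generated G -> nilpotent_group G ->
  irreducible pi -> finite_weight pi -> monomial pi.
Proof.
move=> fgG nilG irr /finite_weight_good[H [W goodHW]].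
have [H1 [W1 [sH1 siW1 fW1 d1]]] := finite_weight_monomial_support fgG nilG
  goodHW.
have [H2 [v [sH2 H21 [Wv v0] H2v d2]]] := simple_monomial nilG sH1 siW1 fW1.
apply: (monomial_of_direct irr sH2 v0 H2v).
apply: (direct_trans sH1 H21 _ d2) => //.
by rewrite (simple_orbit_line sH1 siW1).
Qed.

End MonomialWeight.

(** * Uncountability of the complex numbers *)

Section Uncountable.
Local Open Scope ring_scope.
(** A countable set is Lebesgue-null, whereas the line has infinite measure. *)
Lemma real_uncountable (R : realType) : ~ countable [set: R].
Proof.
have -> : [set: R] = [set` `]-oo, +oo[%R].
  by apply/seteqP; split=> x //= _; rewrite in_itv.
by move=> /countable_lebesgue_measure0; rewrite lebesgue_measure_itv.
Qed.

Lemma complex_uncountable (R : realType) : ~ countable [set: R[i]].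
Proof.
move=> /countable_injP[f f_inj]; apply: (@real_uncountable R).
apply/countable_injP; exists (fun x => f x%:C%C) => x y _ _ /f_inj.
by rewrite !in_setT => /(_ isT isT) [].
Qed.
End Uncountable.

Theorem theoremA (R : realType) (G : groupType) (V : lmodType R[i])
    (pi : representation G V) :
  finitely_generated G -> nilpotent_group G -> irreducible pi ->
  (monomial pi <-> finite_weight pi).
Proof.
move=> fgG nilG irr; split; last exact: finite_weight_monomial.
exact/monomial_finite_weight/irr/complex_uncountable.
Qed.
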